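(* Let $\Gamma$ be a digraph limit. The following are equivalent: (i) $\Gamma$ is a tournament limit; (ii) $t_{\mathrm{ind}}(F,\Gamma)=0$ for every finite digraph $F$ that is not a tournament; (iii) $t_{\mathrm{ind}}(\mathsf C_1,\Gamma)=t_{\mathrm{ind}}(\mathsf C_2,\Gamma)=t_{\mathrm{ind}}(\mathsf E_2,\Gamma)=0$; (iv) every quintuple $\mathbf W=(W_{00},W_{01},W_{10},W_{11},w)$ representing $\Gamma$ satisfies $w=0$, $W_{11}=W_{00}=0$ a.e., and $W_{10}(x,y)+W_{10}(y,x)=1$ for a.e. $(x,y)$.
   Context: Digraphs may have loops; a tournament is a loopless digraph with exactly one of $(u,v),(v,u)$ an edge for distinct $u,v$. $\mathsf C_1$ is one vertex with a loop, $\mathsf C_2$ is two vertices with both edges $(1,2),(2,1)$, $\mathsf E_2$ is two vertices with no edges. For finite digraphs, $t(F,G)=\hom(F,G)/v(G)^{v(F)}$ and $t_{\mathrm{ind}}(F,G)=\mathrm{ind}(F,G)/(v(G))_{v(F)}$ with $\mathrm{ind}$ counting injective maps preserving edges and non-edges. A sequence $(G_n)$ of finite digraphs with $v(G_n)\to\infty$ converges if $t(F,G_n)$ converges for every finite digraph $F$; digraph limits are the limit objects, with $t(F,\Gamma),t_{\mathrm{ind}}(F,\Gamma)$ the limits of the densities; tournament limits are limits of convergent sequences of tournaments. A quintuple on a probability space $(\mathcal S,\mu)$ is $(W_{00},W_{01},W_{10},W_{11},w)$ of measurable functions, $W_{\alpha\beta}:\mathcal S^2\to[0,1]$ with $\sum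 W_{\alpha\beta}=1$ a.e., $W_{00},W_{11}$ a.e. symmetric, $W_{01}(x,y)=W_{10}(y,x)$ a.e., and $w:\mathcal S\to[0,1]$. It defines a random digraph $G(k,\mathbf W)$ on $\{1,\dots,k\}$: draw $X_1,\dots,X_k$ i.i.d. from $\mu$; for $i<j$ independently $\mathbb P[\mathbb 1_{(i,j)\in E}=\alpha,\mathbb 1_{(j,i)\in E}=\beta]=W_{\alpha\beta}(X_i,X_j)$; each vertex $i$ gets a loop independently with probability $w(X_i)$. $\mathbf W$ represents $\Gamma$ if $t(F,\Gamma)=\mathbb P[F\subseteq G(v(F),\mathbf W)]$ for all finite digraphs $F$; then $t_{\mathrm{ind}}(F,\Gamma)=\mathbb P[F=G(v(F),\mathbf W)]$. Every digraph limit is represented by some quintuple. *)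

(* Defs.v *)
From HB Require Import structures.
From mathcomp Require Import all_boot all_order all_algebra.
From mathcomp Require Import all_classical all_reals all_analysis.

Set Implicit Arguments.
Unset Strict Implicit.
Unset Printing Implicit Defensive.

Import Order.TTheory GRing.Theory Num.Theory.
Import numFieldNormedType.Exports.

Local Open Scope classical_set_scope.
Local Open Scope ring_scope.

(* Digraphs are labelled: the vertex set is 'I_n.  Every finite digraph is
   isomorphic to one of this form, and all the densities below are isomorphism
   invariant. *)
Definition edge_set (n : nat) : Type := {set 'I_n * 'I_n}.

Record digraph := Digraph { vnum : nat; edges : edge_set vnum }.

Definition is_tournament (F : digraph) : Prop :=
  (forall i, (i, i) \notin edges F) /\
  (forall i j, i != j -> ((i, j) \in edges F) (+) ((j, i) \in edges F)).

Definition C1 : digraph := @Digraph 1 [set: 'I_1 * 'I_1]%SET.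

Definition C2 : digraph :=
  @Digraph 2 [set (ord0, ord_max); (ord_max, ord0)]%SET.

Definition E2 : digraph := @Digraph 2 finset.set0.

Definition hom (F G : digraph) : nat :=
  #|[set f : {ffun 'I_(vnum F) -> 'I_(vnum G)} |
      [forall i, forall j,
        ((i, j) \in edges F) ==> ((f i, f j) \in edges G)]]%SET|.

Definition ind (F G : digraph) : nat :=
  #|[set f : {ffun 'I_(vnum F) -> 'I_(vnum G)} |
      injectiveb f &&
      [forall i, forall j,
        ((i, j) \in edges F) == ((f i, f j) \in edges G)]]%SET|.

Section Limits.
Variable R : realType.

Definition t (F G : digraph) : R := (hom F G)%:R / (vnum G ^ vnum F)%:R.

Definition tind (F G : digraph) : R := (ind F G)%:R / (vnum G ^_ vnum F)%:R.

Definition converges_to (G : nat -> digraph) (dens : digraph -> R) : Prop :=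
  (vnum (G n) @[n --> \oo] --> \oo) /\
  (forall F, t F (G n) @[n --> \oo] --> dens F).

(* A digraph limit is identified with its family of densities t(F, Gamma). *)
Record digraph_limit := DigraphLimit {
  t_lim : digraph -> R;
  t_limP : exists G : nat -> digraph, converges_to G t_lim }.

Definition is_tournament_limit (Gamma : digraph_limit) : Prop :=
  exists G : nat -> digraph,
    (forall n, is_tournament (G n)) /\ converges_to G (t_lim Gamma).

(* The limit exists and does not depend on the chosen sequence: by inclusion-
   exclusion over the edge sets containing edges F, and because all but a
   fraction O(1 / v(G)) of the maps V(F) -> V(G) are injective, tind F G is
   asymptotically a fixed linear combination of the t F' G with
   vnum F' = vnum F. *)
Definition tind_lim (Gamma : digraph_limit) (F : digraph) : R :=
  lim (tind F (sval (cid (t_limP Gamma)) n) @[n --> \oo]).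

End Limits.

Section ProductPower.
Context d (S : measurableType d) (R : realType).

Definition cons_pair (k : nat) (xs : S * k.-tuple S) : k.+1.-tuple S :=
  [tuple of xs.1 :: xs.2].

Lemma measurable_cons_pair k : measurable_fun [set: _] (@cons_pair k).
Proof. exact: measurable_cons. Qed.

HB.instance Definition _ k :=
  isMeasurableFun.Build _ _ _ _ (@cons_pair k) (@measurable_cons_pair k).

(* the law of (X_1, ..., X_k) for X_1, ..., X_k i.i.d. from mu *)
Fixpoint iid (mu : probability S R) (k : nat) : probability (k.-tuple S) R :=
  match k with
  | 0 => \d_([tuple] : 0.-tuple S)
  | k'.+1 => distribution (mu \x iid mu k')%E (@cons_pair k')
  end.

End ProductPower.

Section Quintuples.
Context d (S : measurableType d) (R : realType) (mu : probability S R).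

(* QW Q a b is W_ab: a says whether there is an edge from the first point to
   the second one, b whether there is one back. *)
Record quintuple := Quintuple {
  QW : bool -> bool -> S * S -> R;
  Qw : S -> R;
  QW_measurable : forall a b, measurable_fun [set: S * S] (QW a b);
  Qw_measurable : measurable_fun [set: S] Qw;
  QW_01 : forall a b z, 0 <= QW a b z <= 1;
  Qw_01 : forall x, 0 <= Qw x <= 1;
  QW_sum : {ae (mu \x mu)%E, forall z,
    QW false false z + QW false true z + QW true false z + QW true true z = 1};
  QW00_sym : {ae (mu \x mu)%E, forall z,
    QW false false (z.1, z.2) = QW false false (z.2, z.1)};
  QW11_sym : {ae (mu \x mu)%E, forall z,
    QW true true (z.1, z.2) = QW true true (z.2, z.1)};
  QW01_10 : {ae (mu \x mu)%E, forall z,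
    QW false true (z.1, z.2) = QW true false (z.2, z.1)} }.

(* the conditional probability that G(k, W) = H given (X_1, ..., X_k) = x *)
Definition cond_pmf (W : quintuple) (k : nat) (x : k.-tuple S)
    (H : edge_set k) : R :=
  (\prod_(p : 'I_k * 'I_k | (p.1 < p.2)%N)
     QW W ((p.1, p.2) \in H) ((p.2, p.1) \in H) (tnth x p.1, tnth x p.2)) *
  (\prod_(i < k)
     (if (i, i) \in H then Qw W (tnth x i) else 1 - Qw W (tnth x i))).

(* the distribution of the random digraph G(k, W) on 'I_k *)
Definition random_digraph (W : quintuple) (k : nat) (A : {set edge_set k}) :
    \bar R :=
  (\int[iid mu k]_x (\sum_(H in A) cond_pmf W x H)%:E)%E.

Definition represents (W : quintuple) (Gamma : digraph_limit R) : Prop :=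
  forall F : digraph, (t_lim Gamma F)%:E =
    random_digraph W
      [set H : edge_set (vnum F) | edges F \subset (H : {set _})]%SET.

End Quintuples.

(* Main.v *)
Require Import Defs.
From HB Require Import structures.
From mathcomp Require Import all_boot all_order all_algebra.
From mathcomp Require Import all_classical all_reals all_analysis.
From mathcomp Require Import measurable_realfun.
From mathcomp Require Import ring lra.

(* By Moebius inversion over edge sets, the limit of the induced densities is a
   fixed linear function of Gamma, and for a representing quintuple it is the
   integral of [cond_pmf]; this gives (i) => (ii) => (iii) => (iv).  For
   (iv) => (i), if the limit densities of C_1, C_2 and E_2 vanish, then
   changing o(n^2) edges turns any sequence converging to Gamma into a sequence
   of tournaments with the same limit.  That (iv) forces these densities
   to vanish requires the existence of a representing quintuple.

   To construct one, the vertices of each G_n are labelled by words: the next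
   letter records the two vertex sets on which the adjacency deviates the most
   from its averages over the blocks of equally labelled vertices.  The deviation
   is controlled by the increment of the energy (the mean square of the block
   averages), so the counting lemma compares G_n with its block averages at level
   m up to the square root of E_(m+1) - E_m.  The limits of the block weights and
   densities along an ultrafilter satisfy the same polynomial relations: the
   weights divide [0, 1[ into nested intervals, on whose products the block
   densities form a bounded martingale of step functions; a subsequence of it
   converges almost everywhere, and its limit is the quintuple. *)

Set Implicit Arguments.
Unset Strict Implicit.
Unset Printing Implicit Defensive.

Import Order.TTheory GRing.Theory Num.Theory.
Import numFieldNormedType.Exports.

Local Open Scope classical_set_scope.
Local Open Scope ring_scope.

(** Digraphs of different orders share no vertex set, so their block averages can be compared only
    if the blocks carry common names. Words of length m over four letters are such names: there are
    4^m of them whatever n is, and lengthening a word refines its block. The energy adds four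
    colours (edge or not, back edge or not), each contributing at most 1, so E_m increases to a
    limit. Levels are chosen beyond which it grows by at most 4^-i; the square root 2^-i then bounds
    both the counting error, up to a constant, and the L^2 norm of one step of the subsequence, and
    its summability gives convergence almost everywhere. Loops are not approximated: the first
    letter added records them, and the estimates therefore start at level 1. Since blocks may be
    empty, or of weight 0 in the limit, relations between densities are kept multiplied by the
    weights. *)

Section FiniteLimits.
Context (R : numFieldType) (I T : Type) (F : set_system T) {FF : Filter F}.
Context (r : seq I) (P : pred I) (f : I -> T -> R) (l : I -> R).
Hypothesis fl : forall i, P i -> f i x @[x --> F] --> l i.

Lemma cvg_sumr :
  \sum_(i <- r | P i) f i x @[x --> F] --> \sum_(i <- r | P i) l i.
Proof. by apply: cvg_big => //; exact: add_continuous. Qed.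

Lemma cvg_prodr :
  \prod_(i <- r | P i) f i x @[x --> F] --> \prod_(i <- r | P i) l i.
Proof. by apply: cvg_big => //; exact: mul_continuous. Qed.

End FiniteLimits.

Lemma cvg_near_eq (T : Type) (U : topologicalType) (F : set_system T)
    {FF : Filter F} (f g : T -> U) (l l' : U) :
  f x @[x --> F] --> l -> l = l' -> (\forall x \near F, f x = g x) ->
  g x @[x --> F] --> l'.
Proof. by move=> fl <- fg; apply: cvg_trans fl; exact: near_eq_cvg. Qed.

(** * Densities and their limits *)

Section Moebius.
Context (R : comNzRingType) (T : finType).

(* The coefficients [c] do not depend on [a]: this gives at once the uniqueness
   of [a], given its sums over supersets, and the passage to the limit. *)
Lemma moebius_inversion (H : {set T}) : exists c : {set T} -> R,
  forall a : {set T} -> R,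
    a H = \sum_(F : {set T}) c F * \sum_(K : {set T} | F \subset K) a K.
Proof.
have [n] := ubnP #|~: H|; elim: n H => // n IH H Hn.
have cE (K : {set T}) : {c : {set T} -> R | H \proper K ->
    forall a : {set T} -> R,
    a K = \sum_(F : {set T}) c F * \sum_(K' : {set T} | F \subset K') a K'}.
  apply: cid; have [HK|_] := boolP (H \proper K); last by exists (fun=> 0).
  have [|c cP] := IH K; last by exists c.
  by apply: leq_trans (proper_card _) Hn; rewrite finset.properC.
pose c K := sval (cE K); have cP K := svalP (cE K).
exists (fun F => (F == H)%:R - \sum_(K : {set T} | H \proper K) c K F) => a.
under eq_bigr do rewrite mulrBl.
rewrite sumrB (bigD1 H)//= eqxx mul1r [X in _ + X - _]big1 ?addr0; last first.
  by move=> F /negPf ->; rewrite mul0r.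
rewrite (bigD1 H)//=.
under [X in _ = _ - X]eq_bigr do rewrite mulr_suml.
rewrite exchange_big/=.
rewrite -[LHS]addr0 -addrA; congr +%R.
apply/esym/eqP; rewrite subr_eq0; apply/eqP.
apply: eq_big => [K|K HK]; first by rewrite finset.properEneq eq_sym andbC.
by rewrite -cP // finset.properEneq eq_sym andbC.
Qed.

End Moebius.

Section Pullback.
Context (R : realType).

Definition pullback k (G : digraph) (f : {ffun 'I_k -> 'I_(vnum G)}) :
  edge_set k := [set ij | (f ij.1, f ij.2) \in edges G]%SET.

(* The density of the maps inducing [H], where, unlike in [tind], non-injective
   maps count as well. *)
Definition pullback_density k (G : digraph) (H : edge_set k) : R :=
  #|[set f : {ffun 'I_k -> 'I_(vnum G)} | pullback f == H]%SET|%:R /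
  (vnum G ^ k)%:R.

(** Each homomorphism is sorted by the edge set that it pulls back. Since non-injective maps count
    on both sides, there is no error term. *)
Lemma t_sum (F G : digraph) :
  t R F G = \sum_(H : edge_set (vnum F) | edges F \subset H)
    pullback_density G H.
Proof.
rewrite /t /pullback_density -mulr_suml -natr_sum; congr (_%:R / _).
rewrite /Defs.hom -sum1_card.
rewrite (partition_big (@pullback (vnum F) G)
  (fun H : edge_set _ => edges F \subset H))/=; last first.
  move=> f; rewrite inE => /forallP fF; apply/fintype.subsetP => -[i j] ij.
  by rewrite inE; have /forallP/(_ j)/implyP := fF i; exact.
apply: eq_bigr => H FH; rewrite -sum1_card; apply: eq_bigl => f.
rewrite !inE andb_idl// => /eqP fH; apply/forallP => i; apply/forallP => j.
by apply/implyP => /(fintype.subsetP FH); rewrite -fH inE.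
Qed.

Lemma pullback_density_ge0 k G (H : edge_set k) : 0 <= pullback_density G H.
Proof. by rewrite divr_ge0. Qed.

Lemma cvg_ffact_ratio (N : nat -> nat) k : (N n @[n --> \oo] --> \oo) ->
  ((N n ^_ k)%:R / (N n ^ k)%:R : R) @[n --> \oo] --> (1 : R).
Proof.
move=> Noo; elim: k => [|k IH].
  by under eq_fun do rewrite ffactn0 expn0 divr1; exact: cvg_cst.
have Ngt m : \forall n \near \oo, (m < N n)%N by exact: Noo (nbhs_infty_gt m).
have N0 : \forall n \near \oo, 0 < (N n)%:R :> R.
  by apply: filterS (Ngt 0%N) => n; rewrite ltr0n.
have NV : (N n)%:R^-1 @[n --> \oo] --> (0 : R).
  by apply/(gtr0_cvgV0 N0); exact/cvgrnyP.
have NB : (1 - k%:R * (N n)%:R^-1) @[n --> \oo] --> (1 - k%:R * 0 : R).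
  by apply: cvgB; [exact: cvg_cst|exact: cvgMr].
apply: (cvg_near_eq (cvgM IH NB)).
  by rewrite mulr0 subr0 mulr1.
near=> n.
have Nk : (k < N n)%N by near: n; exact: Ngt.
have Nn0 : (0 < N n)%N by apply: leq_ltn_trans Nk.
rewrite ffactnSr expnSr !natrM invfM mulrACA natrB 1?ltnW// mulrBl divff//.
by rewrite pnatr_eq0 -lt0n.
Unshelve. all: by end_near. Qed.

(** Rescaled, [tind] counts the injective maps that induce [edges F]. So the left side is the
    proportion of non-injective maps inducing it, and the right side that of all non-injective
    maps. *)
Lemma tind_pullback (F G : digraph) :
  `|pullback_density G (edges F) -
    tind R F G * ((vnum G ^_ vnum F)%:R / (vnum G ^ vnum F)%:R)| <=
  1 - (vnum G ^_ vnum F)%:R / (vnum G ^ vnum F)%:R.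
Proof.
set k := vnum F; set N := vnum G.
pose J := [set f : {ffun 'I_k -> 'I_N} | injectiveb f]%SET.
pose P := [set f : {ffun 'I_k -> 'I_N} | pullback f == edges F]%SET.
have cJ : #|J| = (N ^_ k)%N by rewrite card_inj_ffuns !card_ord.
have indE : ind F G = #|P :&: J|%SET.
  apply: eq_card => f; rewrite !inE andbC; congr andb.
  apply/forallP/eqP => [fF|fF i].
    apply/setP => -[i j]; rewrite inE/=.
    by have /forallP/(_ j)/eqP := fF i.
  by apply/forallP => j; rewrite -fF inE.
have indJ : (ind F G <= N ^_ k)%N by rewrite indE -cJ subset_leq_card// subsetIr.
have -> : tind R F G * ((N ^_ k)%:R / (N ^ k)%:R) = (ind F G)%:R / (N ^ k)%:R.
  (* If [G] has fewer vertices than [F], then [tind] is a quotient by 0, read as 0, and [ind F G]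
     vanishes too. *)
  rewrite /tind -/N -/k; have [Nk0|Nk0] := eqVneq (N ^_ k)%N 0%N.
    by move: indJ; rewrite Nk0 leqn0 => /eqP ->; rewrite !mul0r.
  by rewrite mulrA divfK// pnatr_eq0.
have [Nk0|Nk0] := eqVneq (N ^ k)%N 0%N.
  by rewrite /pullback_density Nk0 invr0 !mulr0 !subr0 normr0.
rewrite /pullback_density -mulrBl indE -(cardsID J P) natrD addrC addKr.
rewrite ger0_norm ?divr_ge0//.
rewrite -[X in X - _](@divff _ (N ^ k)%:R) ?pnatr_eq0// -mulrBl.
rewrite ler_pM2r ?invr_gt0 ?ltr0n ?lt0n//.
have cT : #|{: {ffun 'I_k -> 'I_N}}| = (N ^ k)%N by rewrite card_ffun !card_ord.
rewrite lerBrDr -natrD ler_nat -cT -cJ -cardsUI.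
rewrite [X in (_ + X)%N](_ : _ = 0%N) ?addn0 ?max_card//.
apply/eqP; rewrite cards_eq0; apply/eqP/setP => f; rewrite !inE.
by case: injectiveb; rewrite ?andbF.
Qed.

Lemma cvg_tind (F : digraph) (G : nat -> digraph) (q : R) :
  (vnum (G n) @[n --> \oo] --> \oo) ->
  (pullback_density (G n) (edges F) @[n --> \oo] --> q) ->
  (tind R F (G n) @[n --> \oo] --> q).
Proof.
move=> Noo pq.
pose r n : R := (vnum (G n) ^_ vnum F)%:R / (vnum (G n) ^ vnum F)%:R.
have r1 : r n @[n --> \oo] --> (1 : R) by exact: cvg_ffact_ratio.
have tr : tind R F (G n) * r n @[n --> \oo] --> q.
  have : (pullback_density (G n) (edges F) - tind R F (G n) * r n) @[n --> \oo]
      --> (0 : R).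
    apply/norm_cvg0P; apply: (@squeeze_cvgr _ _ _ _ (fun=> 0) (fun n => 1 - r n)).
    - by near=> n; rewrite normr_ge0 tind_pullback.
    - exact: cvg_cst.
    - by rewrite -(subrr 1); apply: cvgB => //; exact: cvg_cst.
  move=> d0; apply: (cvg_near_eq (cvgB pq d0)); first by rewrite subr0.
  by near=> n; rewrite /= opprB addrC subrK.
apply: (cvg_near_eq (cvgM tr (cvgV (oner_neq0 _) r1))).
  by rewrite invr1 mulr1.
near=> n.
rewrite /= mulfK// gt_eqF//.
by near: n; apply: (cvgr_gt (1 : R)) => //; exact: ltr01.
Unshelve. all: by end_near. Qed.

(** [q] is quantified before [G]: being a linear combination of values of [t_lim Gamma], the limit
    is the same along every sequence, whether made of tournaments or chosen by [tind_lim]. *)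
Lemma cvg_pullback_density (Gamma : digraph_limit R) k (H : edge_set k) :
  exists q : R, forall G : nat -> digraph, converges_to G (t_lim Gamma) ->
  pullback_density (G n) H @[n --> \oo] --> q.
Proof.
have [c cP] := moebius_inversion R H.
exists (\sum_(F : edge_set k) c F * t_lim Gamma (Digraph F)) => G [_ Gt].
under eq_fun do rewrite cP.
apply: cvg_sumr => F _; apply: cvgMr.
by under eq_fun do rewrite -(t_sum (Digraph F)); exact: Gt.
Qed.

Definition lim_density (Gamma : digraph_limit R) k (H : edge_set k) : R :=
  sval (cid (cvg_pullback_density Gamma H)).

Lemma lim_densityP (Gamma : digraph_limit R) k (H : edge_set k)
    (G : nat -> digraph) : converges_to G (t_lim Gamma) ->
  pullback_density (G n) H @[n --> \oo] --> lim_density Gamma H.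
Proof. exact: (svalP (cid (cvg_pullback_density Gamma H)) G). Qed.

Lemma tind_limE (Gamma : digraph_limit R) F :
  tind_lim Gamma F = lim_density Gamma (edges F).
Proof.
rewrite /tind_lim; case: cid => G /= GP; apply/cvg_lim => //.
by apply: cvg_tind; [case: GP|exact: lim_densityP].
Qed.

Lemma t_lim_sum (Gamma : digraph_limit R) F :
  t_lim Gamma F = \sum_(H : edge_set (vnum F) | edges F \subset H)
    lim_density Gamma H.
Proof.
have [G GP] := t_limP Gamma.
have Ft : t R F (G n) @[n --> \oo] -->
    \sum_(H : edge_set (vnum F) | edges F \subset H) lim_density Gamma H.
  under eq_fun do rewrite t_sum.
  by apply: cvg_sumr => H _; exact: lim_densityP.
by apply: (cvg_unique _ (GP.2 F) Ft) => //.
Qed.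

Lemma lim_density_unique (Gamma : digraph_limit R) k (r : edge_set k -> R) :
  (forall F : edge_set k, t_lim Gamma (Digraph F) =
    \sum_(H : edge_set k | F \subset H) r H) ->
  r =1 lim_density Gamma (k:=k).
Proof.
move=> rP H; have [c cP] := moebius_inversion R H.
rewrite [LHS]cP [RHS]cP; apply: eq_bigr => F _.
by rewrite -[in LHS]rP t_lim_sum.
Qed.

Lemma tournament_limit_tind0 (Gamma : digraph_limit R) F :
  is_tournament_limit Gamma -> ~ is_tournament F -> tind_lim Gamma F = 0.
Proof.
move=> [G [GT GP]] FT; rewrite tind_limE.
have Gq := cvg_tind GP.1 (lim_densityP (H := edges F) GP).
suff t0 : tind R F (G n) @[n --> \oo] --> (0 : R).
  by apply: (cvg_unique _ Gq t0) => //.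
apply: (@cvg_near_eq _ _ _ _ (fun=> 0) _ 0 0) => //; first exact: cvg_cst.
apply: nearW => n; rewrite /tind (_ : ind F (G n) = 0)%N ?mul0r//.
apply/eqP; rewrite cards_eq0; apply/eqP/setP => f; rewrite !inE.
apply/negP => /andP[/injectiveP finj /forallP fF]; apply: FT.
have fE i j : ((i, j) \in edges F) = ((f i, f j) \in edges (G n)).
  by have /forallP/(_ j)/eqP := fF i.
have [Gl Gt] := GT n; split=> [i|i j ij]; first by rewrite fE.
by rewrite !fE Gt// (inj_eq finj).
Qed.

End Pullback.

(** * Editing digraphs into tournaments *)

Section Overwrite.
Context (I J V : finType) (phi : J -> I).
Hypothesis phi_inj : injective phi.

(** Resampling of the coordinates in the image of [phi]. The identity [sum_overwrite] plays the role
    of Fubini: it serves to restrict maps to fewer vertices, and later to isolate the two ends of an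
    edge. *)
Definition overwrite (f : {ffun I -> V}) (g : {ffun J -> V}) : {ffun I -> V} :=
  [ffun i => if [pick j | phi j == i] is Some j then g j else f i].

Lemma overwrite_in f g j : overwrite f g (phi j) = g j.
Proof.
rewrite ffunE; case: pickP => [j' /eqP/phi_inj ->//|/(_ j)].
by rewrite eqxx.
Qed.

Lemma overwrite_out f g i : (forall j, phi j != i) -> overwrite f g i = f i.
Proof.
by move=> ji; rewrite ffunE; case: pickP => // j; rewrite (negPf (ji j)).
Qed.

(* [(f, g) |-> (overwrite f g, f \o phi)] is an involution. *)
Lemma sum_overwrite (R : nmodType) (X : {ffun I -> V} -> R) :
  \sum_f \sum_g X (overwrite f g) = (\sum_f X f) *+ (#|V| ^ #|J|).
Proof.
pose swap (fg : {ffun I -> V} * {ffun J -> V}) :=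
  (overwrite fg.1 fg.2, [ffun j => fg.1 (phi j)]).
have swapK : involutive swap.
  move=> [f g]; congr pair; apply/ffunP => i; last first.
    by rewrite ffunE overwrite_in.
  have [/existsP[j /eqP <-]|/existsPn ji] := boolP [exists j, phi j == i].
    by rewrite overwrite_in ffunE.
  by rewrite !overwrite_out.
rewrite pair_bigA/= (reindex_inj (inv_inj swapK))/=.
rewrite (eq_bigr (fun fg => X fg.1)) => [|[f g] _]; last first.
  by congr X; exact: (congr1 fst (swapK (f, g))).
rewrite -(pair_bigA _ (fun f (g : {ffun J -> V}) => X f))/= -sumrMnl.
by apply: eq_bigr => f _; rewrite sumr_const card_ffun.
Qed.

End Overwrite.

Section Editing.
Context (R : realType).

(** A uniform random map restricts along [phi] to a uniform random map, and if the former induces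
    [H], the latter induces [F]. *)
Lemma pullback_density_le k l (phi : 'I_l -> 'I_k) G (H : edge_set k)
    (F : edge_set l) : (0 < vnum G)%N -> injective phi ->
  (forall i j, ((i, j) \in F) = ((phi i, phi j) \in H)) ->
  pullback_density R G H <= pullback_density R G F.
Proof.
move=> N0 phi_inj FH; pose N := vnum G.
have Nk m : 0 < (N ^ m)%:R :> R by rewrite ltr0n expn_gt0 N0.
rewrite /pullback_density -/N ler_pdivrMr// mulrAC ler_pdivlMr// -!natrM ler_nat.
pose X (f : {ffun 'I_k -> 'I_N}) : nat :=
  pullback [ffun j : 'I_l => f (phi j)] == F.
have XE : (\sum_f \sum_g X (overwrite phi f g) = (\sum_f X f) * N ^ l)%N.
  have := sum_overwrite phi_inj X.
  by rewrite -mulr_natr natn !card_ord; exact.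
(* Restricted along [phi], [overwrite phi f g] is [g], so the inner sum is the same for all [f]. *)
rewrite (eq_bigr (fun=>
    #|[set g : {ffun 'I_l -> 'I_N} | pullback g == F]%SET|)) in XE.
  rewrite sum_nat_const card_ffun !card_ord mulnC in XE.
  rewrite XE leq_mul2r.
  apply/orP; right; rewrite -sum1_card big_mkcond/=; apply: leq_sum => f _.
  rewrite inE; case: eqP => // fH; rewrite lt0b; apply/eqP/setP => -[i j].
  by rewrite FH -fH !inE !ffunE.
move=> f _; rewrite -sum1_card [RHS]big_mkcond/=; apply: eq_bigr => g _.
rewrite inE /X; case: ifP => [/eqP <-|/eqP gF];
  rewrite (_ : [ffun _ => _] = g) ?eqxx//.
- by apply/ffunP => j; rewrite ffunE overwrite_in.
- by move/eqP/negPf: gF => ->.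
- by apply/ffunP => j; rewrite ffunE overwrite_in.
Qed.

Definition tournamentb k (H : edge_set k) : bool :=
  [forall i, forall j,
    if i == j then (i, j) \notin H else ((i, j) \in H) (+) ((j, i) \in H)].

Definition tournamentize (G : digraph) : digraph :=
  @Digraph (vnum G) [set ij | (ij.1 != ij.2) &&
    (if (ij \in edges G) (+) ((ij.2, ij.1) \in edges G)
     then ij \in edges G else (ij.1 < ij.2)%N)]%SET.

Lemma tournamentizeP G : is_tournament (tournamentize G).
Proof.
split=> [i|i j ij]; first by rewrite inE eqxx.
rewrite !inE/= ij eq_sym ij/= addbC.
by case: (_ \in _); case: (_ \in _) => //=; case: ltngtP ij => // /ord_inj ->;
  rewrite eqxx.
Qed.

(** The hypothesis makes [f] injective: two indices with the same image would read the same bit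
    twice, and its exclusive or with itself is false. So [f] meets only pairs that the editing
    leaves alone. *)
Lemma tournamentize_pullback k G (f : {ffun 'I_k -> 'I_(vnum G)}) :
  tournamentb (pullback f) -> @pullback k (tournamentize G) f = pullback f.
Proof.
move=> /forallP fT; apply/setP => -[i j]; rewrite !inE/=.
have /forallP/(_ j) := fT i; rewrite !inE/=.
have [->|ij] := eqVneq i j; first by rewrite eqxx => /negPf ->.
move=> e; rewrite e; have [fij|//] := eqVneq (f i) (f j).
by move: e; rewrite fij addbb.
Qed.

(** Only maps whose pullback is not a tournament feel the editing, and each changes the count by at
    most 1. The edit is thus measured directly by densities that [lim_density_non_tournament] sends
    to 0. *)
Lemma t_tournamentize F G : (0 < vnum G)%N ->
  `|t R F G - t R F (tournamentize G)| <=
  \sum_(H : edge_set (vnum F) | ~~ tournamentb H) pullback_density R G H.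
Proof.
move=> N0; rewrite /t /pullback_density/= -mulrBl normrM.
rewrite [X in _ * X]ger0_norm ?invr_ge0// -mulr_suml ler_pM2r; last first.
  by rewrite invr_gt0 ltr0n expn_gt0 N0.
have homE (G' : digraph) : Defs.hom F G' =
    (\sum_(f : {ffun 'I_(vnum F) -> 'I_(vnum G')}) (edges F \subset pullback f))%N.
  rewrite /Defs.hom -sum1_card big_mkcond/=; apply: eq_bigr => f _.
  rewrite inE (_ : [forall i, _] = (edges F \subset pullback f))//.
  apply/forallP/fintype.subsetP => [fF [i j] ij|fF i].
    by rewrite inE; have /forallP/(_ j)/implyP := fF i; exact.
  by apply/forallP => j; apply/implyP => /fF; rewrite inE.
rewrite !homE !natr_sum -sumrB; apply: (le_trans (ler_norm_sum _ _ _)).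
rewrite -natr_sum.
have -> : (\sum_(H : edge_set (vnum F) | ~~ tournamentb H)
    #|[set f : {ffun 'I_(vnum F) -> 'I_(vnum G)} | pullback f == H]%SET| =
    \sum_(f : {ffun 'I_(vnum F) -> 'I_(vnum G)}) ~~ tournamentb (pullback f))%N.
  transitivity (#|[set f : {ffun 'I_(vnum F) -> 'I_(vnum G)} |
      ~~ tournamentb (pullback f)]%SET|); last first.
    rewrite -sum1_card [LHS]big_mkcond/=; apply: eq_bigr => f _.
    by rewrite inE; case: tournamentb.
  rewrite -[RHS]sum1_card (partition_big (@pullback (vnum F) G)
    (fun H => ~~ tournamentb H))/=; last by move=> f; rewrite inE.
  apply: eq_bigr => H HT; rewrite -sum1_card; apply: eq_bigl => f.
  by rewrite !inE andb_idl// => /eqP ->.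
rewrite natr_sum; apply: ler_sum => f _.
have [fT|fT] := boolP (tournamentb (pullback f)).
  by rewrite tournamentize_pullback// subrr normr0.
by case: (_ \subset _); case: (_ \subset _);
  rewrite ?subrr ?subr0 ?sub0r ?normrN ?normr0 ?normr1.
Qed.

(** A failure of [tournamentb] shows at a loop, or at a loopless pair with two edges or none, hence
    as an induced [C1], [C2] or [E2]. Restricting to these one or two vertices cannot decrease the
    density. *)
Lemma lim_density_non_tournament (Gamma : digraph_limit R) k (H : edge_set k) :
  lim_density Gamma (edges C1) = 0 ->
  lim_density Gamma (edges C2) = 0 ->
  lim_density Gamma (edges E2) = 0 ->
  ~~ tournamentb H -> lim_density Gamma H = 0.
Proof.
move=> c1 c2 e2.
have [G GP] := t_limP Gamma.
have N0 : \forall n \near \oo, (0 < vnum (G n))%N.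
  exact: GP.1 (nbhs_infty_gt 0%N).
have le0 l (phi : 'I_l -> 'I_k) (F : edge_set l) : injective phi ->
    (forall i j, ((i, j) \in F) = ((phi i, phi j) \in H)) ->
    lim_density Gamma F = 0 -> lim_density Gamma H = 0.
  move=> phi_inj FH F0; apply/eqP; rewrite eq_le; apply/andP; split.
    rewrite -F0; apply: (ler_cvg_to (lim_densityP GP) (lim_densityP GP)).
    by apply: filterS N0 => n n0; exact: pullback_density_le FH.
  apply: (ler_cvg_to (cvg_cst (0 : R)) (lim_densityP GP)).
  by apply: nearW => n; exact: pullback_density_ge0.
have [/existsP[i ii]|/existsPn loopless] := boolP [exists i, (i, i) \in H].
  move=> _; apply: (le0 1%N (fun=> i) (edges C1)) c1 => [x y _|x y].
    by rewrite !ord1.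
  by rewrite ii inE.
rewrite negb_forall => /existsP[i]; rewrite negb_forall => /existsP[j].
case: eqVneq => [->|ij]; first by rewrite negbK (negPf (loopless j)).
rewrite negb_add => /eqP Hij.
pose phi (x : 'I_2) := if x == ord0 then i else j.
have phi_inj : injective phi.
  move=> [[|[|//]] p] [[|[|//]] q]; rewrite /phi -!val_eqE/= => e;
    by apply/val_inj => //=; move: ij; rewrite e eqxx.
have [ijH|ijH] := boolP ((i, j) \in H).
  apply: (le0 2%N phi (edges C2)) c2 => // x y.
  rewrite !inE /phi ?xpair_eqE; case: x y => [[|[|//]] p] [[|[|//]] q];
    rewrite -?val_eqE /= ?(negPf (loopless _))//.
  by rewrite -Hij ijH eqxx.
apply: (le0 2%N phi (edges E2)) e2 => // x y.
rewrite !inE /phi ?xpair_eqE; case: x y => [[|[|//]] p] [[|[|//]] q];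
    rewrite -?val_eqE /= ?(negPf (loopless _))//.
  by rewrite (negPf ijH).
by rewrite -Hij (negPf ijH).
Qed.

Lemma tournament_limit_of_lim_density (Gamma : digraph_limit R) :
  lim_density Gamma (edges C1) = 0 ->
  lim_density Gamma (edges C2) = 0 ->
  lim_density Gamma (edges E2) = 0 -> is_tournament_limit Gamma.
Proof.
move=> c1 c2 e2; have [G GP] := t_limP Gamma.
exists (fun n => tournamentize (G n)); split=> [n|]; first exact: tournamentizeP.
split=> [|F]; first exact: GP.1.
have s0 : \sum_(H : edge_set (vnum F) | ~~ tournamentb H)
    pullback_density R (G n) H @[n --> \oo] --> (0 : R).
  apply: (@cvg_near_eq _ _ _ _ _ _ _ 0 (cvg_sumr
    (P := fun H => ~~ tournamentb H) (fun H _ => lim_densityP (H := H) GP))).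
    by apply: big1 => H HT; exact: lim_density_non_tournament.
  exact: nearW.
have d0 : t R F (G n) - t R F (tournamentize (G n)) @[n --> \oo] --> (0 : R).
  apply/norm_cvg0P; apply: squeeze_cvgr s0; last exact: cvg_cst.
  have N0 : \forall n \near \oo, (0 < vnum (G n))%N.
    exact: GP.1 (nbhs_infty_gt 0%N).
  by apply: filterS N0 => n n0; rewrite normr_ge0 t_tournamentize.
apply: (cvg_near_eq (cvgB (GP.2 F) d0)); first by rewrite subr0.
by near=> n; rewrite /= opprB addrC subrK.
Unshelve. all: by end_near.
Qed.

End Editing.

(** * Sampling from a quintuple *)

Section Iid.
Local Open Scope ereal_scope.
Context d (S : measurableType d) (R : realType) (mu : probability S R).

Lemma integral_iidS k (f : k.+1.-tuple S -> \bar R) :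
  measurable_fun [set: k.+1.-tuple S] f -> (forall x, 0 <= f x) ->
  \int[iid mu k.+1]_x f x =
  \int[mu]_x \int[iid mu k]_xs f [the k.+1.-tuple S of x :: xs].
Proof.
move=> mf f0; rewrite ge0_integral_distribution//.
rewrite fubini_tonelli1//=.
by apply: measurableT_comp => //; exact: measurable_cons_pair.
Qed.

Lemma integral_iid_tnth k (i : 'I_k) (f : S -> \bar R) :
  measurable_fun [set: S] f -> (forall x, 0 <= f x) ->
  \int[iid mu k]_x f (tnth x i) = \int[mu]_x f x.
Proof.
move=> mf f0; elim: k i => [|k IH] i; first by case: i.
rewrite integral_iidS; last 2 first.
- by apply: measurableT_comp => //; exact: measurable_tnth.
- by move=> x; exact: f0.
case: (unliftP ord0 i) => [j|] ->.
  under eq_integral => x _ do under eq_integral => xs _ do rewrite tnthS.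
  by rewrite IH integral_cst//= probability_setT mule1.
under eq_integral => x _ do under eq_integral => xs _ do rewrite tnth0.
under eq_integral do rewrite integral_cst//= probability_setT mule1.
by [].
Qed.

Lemma integral_iid_pair k (i j : 'I_k) (f : S * S -> \bar R) :
  (i < j)%N -> measurable_fun [set: S * S] f -> (forall x, 0 <= f x) ->
  \int[iid mu k]_x f (tnth x i, tnth x j) = \int[(mu \x mu)]_z f z.
Proof.
move=> ij mf f0; elim: k i j ij => [|k IH] i j ij; first by case: i ij.
rewrite integral_iidS; last 2 first.
- apply: measurableT_comp => //; apply/measurable_fun_pair => /=;
    exact: measurable_tnth.
- by move=> x; exact: f0.
case: (unliftP ord0 j) ij => [j' ->|->//]; case: (unliftP ord0 i) => [i' ->|->] ij.
  under eq_integral => x _ do under eq_integral => xs _ do rewrite !tnthS.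
  by rewrite IH// integral_cst//= probability_setT mule1.
under eq_integral => x _ do under eq_integral => xs _ do rewrite tnthS tnth0.
rewrite fubini_tonelli1//; apply: eq_integral => x _.
rewrite (@integral_iid_tnth k j' (fun y => f (x, y)))//.
by apply: measurableT_comp => //; exact: measurable_pair1.
Qed.

Lemma ae_prod1 (P : S -> Prop) : {ae mu, forall x, P x} ->
  {ae (mu \x mu), forall z, P z.1}.
Proof.
move=> [N [mN N0 PN]]; exists (N `*` setT); split.
- exact: measurableX.
- by rewrite product_measure1E//= N0 mul0e.
- by move=> z /= Pz; split => //; exact: PN.
Qed.

Lemma ae_prod2 (P : S -> Prop) : {ae mu, forall x, P x} ->
  {ae (mu \x mu), forall z, P z.2}.
Proof.
move=> [N [mN N0 PN]]; exists (setT `*` N); split.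
- exact: measurableX.
- by rewrite product_measure1E//= N0 mule0.
- by move=> z /= Pz; split => //; exact: PN.
Qed.

End Iid.

Lemma integral0_ae d (T : measurableType d) (R : realType)
    (nu : {measure set T -> \bar R}) (f : T -> R) :
  measurable_fun [set: T] f -> (forall x, 0 <= f x) ->
  (\int[nu]_x (f x)%:E = 0)%E -> {ae nu, forall x, f x = 0}.
Proof.
move=> mf f0 If.
have mEf : measurable_fun [set: T] (EFin \o f) by exact/measurable_EFinP.
have : ae_eq nu setT (EFin \o f) (cst 0%E).
  apply/(ae_eq_integral_abs _ measurableT mEf); rewrite -[RHS]If.
  by apply: eq_integral => x _ /=; rewrite ger0_norm.
by apply: filterS => x /= /(_ I) [].
Qed.

Lemma ae0_integral d (T : measurableType d) (R : realType)
    (nu : {measure set T -> \bar R}) (f : T -> R) :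
  measurable_fun [set: T] f -> (forall x, 0 <= f x) ->
  {ae nu, forall x, f x = 0} -> (\int[nu]_x (f x)%:E = 0)%E.
Proof.
move=> mf f0 fae.
have mEf : measurable_fun [set: T] (EFin \o f) by exact/measurable_EFinP.
transitivity (\int[nu]_x `|(EFin \o f) x|)%E.
  by apply: eq_integral => x _ /=; rewrite ger0_norm.
apply/(ae_eq_integral_abs _ measurableT mEf).
by apply: filterS fae => x /= -> _.
Qed.

(* [cond_pmf W] is convertible to [kernel_pmf (QW W) (Qw W)]. *)
Definition kernel_pmf (R : pzRingType) (T : Type)
    (K : bool -> bool -> T * T -> R) (w : T -> R)
    (k : nat) (x : k.-tuple T) (H : edge_set k) : R :=
  (\prod_(p : 'I_k * 'I_k | (p.1 < p.2)%N)
     K ((p.1, p.2) \in H) ((p.2, p.1) \in H) (tnth x p.1, tnth x p.2)) *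
  (\prod_(i < k) (if (i, i) \in H then w (tnth x i) else 1 - w (tnth x i))).

Lemma kernel_pmf_01 (R : realDomainType) (T : Type)
    (K : bool -> bool -> T * T -> R) (w : T -> R) k (x : k.-tuple T)
    (H : edge_set k) :
  (forall a b z, 0 <= K a b z <= 1) -> (forall y, 0 <= w y <= 1) ->
  0 <= kernel_pmf K w x H <= 1.
Proof.
move=> K_01 w_01.
have w1_01 y : 0 <= 1 - w y <= 1.
  by have /andP[w0 w1] := w_01 y; rewrite subr_ge0 w1 gerBl w0.
have K0 : 0 <= \prod_(p : 'I_k * 'I_k | (p.1 < p.2)%N)
     K ((p.1, p.2) \in H) ((p.2, p.1) \in H) (tnth x p.1, tnth x p.2) <= 1.
  rewrite prodr_ile1 ?prodr_ge0// => i _.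
  by have /andP[] := K_01 ((i.1, i.2) \in H) ((i.2, i.1) \in H)
    (tnth x i.1, tnth x i.2).
have w0 : 0 <= \prod_(i < k)
    (if (i, i) \in H then w (tnth x i) else 1 - w (tnth x i)) <= 1.
  rewrite prodr_ile1 ?prodr_ge0// => i _; case: ifP => _ //.
  - by have /andP[] := w_01 (tnth x i).
  - by have /andP[] := w1_01 (tnth x i).
move/andP: K0 => [K0 K1]; move/andP: w0 => [w0 w1].
by rewrite /kernel_pmf mulr_ge0// mulr_ile1.
Qed.

Section CondPmf.
Context d (S : measurableType d) (R : realType).

Variables (K : bool -> bool -> S * S -> R) (w : S -> R).
Hypothesis K_measurable : forall a b, measurable_fun [set: S * S] (K a b).
Hypothesis w_measurable : measurable_fun [set: S] w.

Lemma measurable_kernel_pmf k (H : edge_set k) :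
  measurable_fun [set: k.-tuple S] (fun x : k.-tuple S => kernel_pmf K w x H).
Proof.
apply: measurable_funM.
  under eq_fun do rewrite big_mkcond/=.
  apply: measurable_prod => -[i j] _ /=; case: (i < j)%N => //.
  apply: measurableT_comp => //; apply/measurable_fun_pair => /=;
    exact: measurable_tnth.
apply: measurable_prod => i _.
have mwi : measurable_fun [set: k.-tuple S] (fun x => w (tnth x i)).
  by apply: measurableT_comp => //; exact: measurable_tnth.
by case: (_ \in _) => //; exact: measurable_funB.
Qed.

End CondPmf.

Section Represented.
Context d (S : measurableType d) (R : realType) (mu : probability S R).
Variables (W : quintuple mu) (Gamma : digraph_limit R).

Lemma measurable_cond_pmf k (H : edge_set k) :
  measurable_fun [set: k.-tuple S] (fun x : k.-tuple S => cond_pmf W x H).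
Proof.
exact: (measurable_kernel_pmf (@QW_measurable _ _ _ _ W)
  (@Qw_measurable _ _ _ _ W) H).
Qed.

Lemma cond_pmf_01 k (x : k.-tuple S) (H : edge_set k) : 0 <= cond_pmf W x H <= 1.
Proof. exact: (kernel_pmf_01 _ _ (@QW_01 _ _ _ _ W) (@Qw_01 _ _ _ _ W)). Qed.

Lemma random_digraph_sum k (A : {set edge_set k}) :
  random_digraph W A = (\sum_(H in A) \int[iid mu k]_x (cond_pmf W x H)%:E)%E.
Proof.
pose g H (x : k.-tuple S) := if H \in A then cond_pmf W x H else 0.
have g0 H x : 0 <= g H x.
  by rewrite /g; case: ifP => // _; have /andP[] := cond_pmf_01 x H.
have mg H : measurable_fun [set: k.-tuple S] (g H).
  by rewrite /g; case: (H \in A) => //; exact: measurable_cond_pmf.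
transitivity (\int[iid mu k]_x \sum_H (g H x)%:E)%E.
  by apply: eq_integral => x _; rewrite sumEFin big_mkcond.
rewrite ge0_integral_sum//; last 2 first.
- by move=> H; apply/measurable_EFinP.
- by move=> H x _; rewrite lee_fin.
rewrite [RHS]big_mkcond/=; apply: eq_bigr => H _; rewrite /g.
by case: ifP => // _; exact: integral0.
Qed.

Lemma cond_pmf_fin k (H : edge_set k) :
  (\int[iid mu k]_x (cond_pmf W x H)%:E)%E \is a fin_num.
Proof.
have I0 : (0 <= \int[iid mu k]_x (cond_pmf W x H)%:E)%E.
  by apply: integral_ge0 => x _; rewrite lee_fin; have /andP[] := cond_pmf_01 x H.
rewrite ge0_fin_numE//; apply: (@le_lt_trans _ _ 1%E); last exact: ltry.
rewrite -[leRHS](@probability_setT _ _ _ (iid mu k)) -[leRHS]mul1e -integral_cst//.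
apply: ge0_le_integral => //.
- by move=> x _; rewrite lee_fin; have /andP[] := cond_pmf_01 x H.
- by apply/measurable_EFinP; exact: measurable_cond_pmf.
- by move=> x _; rewrite lee_fin; have /andP[] := cond_pmf_01 x H.
Qed.

(** [represents] compares sums over the supersets of [edges F]. Moebius inversion separates them
    into one equation per edge set: the induced densities are the probabilities of the values of
    G(k, W). *)
Lemma represents_lim_density : represents W Gamma <->
  forall k (H : edge_set k),
    (lim_density Gamma H)%:E = (\int[iid mu k]_x (cond_pmf W x H)%:E)%E.
Proof.
split=> [WG k H|WG F]; last first.
  rewrite t_lim_sum -sumEFin random_digraph_sum.
  by apply: eq_big => [H|H _]; rewrite ?inE.
rewrite -(fineK (cond_pmf_fin H)); congr EFin.
rewrite -(lim_density_unique (r := fun H =>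
  fine (\int[iid mu k]_x (cond_pmf W x H)%:E)%E))//.
move=> F; apply: EFin_inj; rewrite WG random_digraph_sum -sumEFin.
by apply: eq_big => [H'|H' _]; rewrite ?inE// fineK// cond_pmf_fin.
Qed.

Hypothesis WG : represents W Gamma.

Lemma integral_Qw : (\int[mu]_x (Qw W x)%:E = (lim_density Gamma (edges C1))%:E)%E.
Proof.
rewrite (represents_lim_density.1 WG).
rewrite -(@integral_iid_tnth _ _ _ mu 1 ord0 (EFin \o Qw W)).
- apply: eq_integral => x _; rewrite /cond_pmf big_pred0 ?mul1r; last first.
    by move=> [i j]; rewrite !ord1.
  by rewrite big_ord1 inE.
- by apply/measurable_EFinP; exact: Qw_measurable.
- by move=> x; rewrite lee_fin; have /andP[] := Qw_01 W x.
Qed.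

(* For [i < j], the conditional probability that the vertices [i] and [j] are
   loopless and joined in both directions ([b = true]) or in none. *)
Definition loopless_pair b (z : S * S) : R :=
  QW W b b z * ((1 - Qw W z.1) * (1 - Qw W z.2)).

Lemma measurable_loopless_pair b : measurable_fun [set: S * S] (loopless_pair b).
Proof.
apply: measurable_funM; first exact: QW_measurable.
apply: measurable_funM; apply: measurable_funB => //;
  by apply: measurableT_comp => //; exact: Qw_measurable.
Qed.

Lemma loopless_pair_ge0 b z : 0 <= loopless_pair b z.
Proof.
have /andP[Q0 _] := QW_01 W b b z.
have /andP[_ w1] := Qw_01 W z.1; have /andP[_ w2] := Qw_01 W z.2.
by rewrite !mulr_ge0 ?subr_ge0.
Qed.

Lemma integral_QW_loopless b (H : edge_set 2) :
  (forall i, (i, i) \notin H) -> (forall i j, i != j -> ((i, j) \in H) = b) ->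
  (\int[(mu \x mu)]_z (loopless_pair b z)%:E = (lim_density Gamma H)%:E)%E.
Proof.
move=> Hl Hb; rewrite (represents_lim_density.1 WG).
rewrite -(@integral_iid_pair _ _ _ mu 2 ord0 ord_max
  (fun z => (loopless_pair b z)%:E))//.
- apply: eq_integral => x _; rewrite /loopless_pair /cond_pmf.
  rewrite (big_pred1 (ord0, ord_max)); last first.
    by move=> [[[|[|//]] p] [[|[|//]] q]].
  rewrite /= !Hb// big_ord_recl big_ord1 !(negPf (Hl _)).
  by rewrite (_ : lift ord0 ord0 = ord_max)//; apply/val_inj.
- by apply/measurable_EFinP; exact: measurable_loopless_pair.
- by move=> z; rewrite lee_fin loopless_pair_ge0.
Qed.

Lemma represents_ae :
  lim_density Gamma (edges C1) = 0 ->
  lim_density Gamma (edges C2) = 0 ->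
  lim_density Gamma (edges E2) = 0 ->
  {ae mu, forall x, Qw W x = 0} /\
  {ae (mu \x mu)%E, forall z, QW W true true z = 0} /\
  {ae (mu \x mu)%E, forall z, QW W false false z = 0} /\
  {ae (mu \x mu)%E, forall z,
    QW W true false (z.1, z.2) + QW W true false (z.2, z.1) = 1}.
Proof.
move=> c1 c2 e2.
(* Loops come first: [loopless_pair b] carries factors [1 - Qw W], so its vanishing says something
   about [QW W b b] only where [Qw W] is not 1. *)
have w0 : {ae mu, forall x, Qw W x = 0}.
  apply: integral0_ae; first exact: Qw_measurable.
  - by move=> x; have /andP[] := Qw_01 W x.
  - by rewrite integral_Qw c1.
have Wb0 b (H : edge_set 2) : (forall i, (i, i) \notin H) ->
    (forall i j, i != j -> ((i, j) \in H) = b) -> lim_density Gamma H = 0 ->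
    {ae (mu \x mu)%E, forall z, QW W b b z = 0}.
  move=> Hl Hb H0.
  have W0 : {ae (mu \x mu)%E, forall z, loopless_pair b z = 0}.
    apply: integral0_ae; first exact: measurable_loopless_pair.
    - exact: loopless_pair_ge0.
    - by rewrite (integral_QW_loopless Hl Hb) H0.
  apply: filterS3 W0 (ae_prod1 w0) (ae_prod2 w0) => z /= h h1 h2.
  by move: h; rewrite /loopless_pair h1 h2 subr0 !mulr1.
have W11 : {ae (mu \x mu)%E, forall z, QW W true true z = 0}.
  apply: Wb0 c2 => [i|i j ij].
    by rewrite !inE; case: i => -[|[|//]] p.
  by rewrite !inE; case: i j ij => [[|[|//]] p] [[|[|//]] q].
have W00 : {ae (mu \x mu)%E, forall z, QW W false false z = 0}.
  by apply: Wb0 e2 => [i|i j ij]; rewrite inE.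
split=> //; split=> //; split=> //.
(* What remains of [QW_sum] is W01 + W10 = 1, and W01(x, y) is W10(y, x). *)
apply: filterS3 W11 W00 (filterI (QW_sum W) (QW01_10 W)) => -[x y] /= h1 h0 [].
by rewrite h1 h0 add0r addr0 => + <-; rewrite addrC.
Qed.

Lemma represents_ae_lim_density :
  {ae mu, forall x, Qw W x = 0} ->
  {ae (mu \x mu)%E, forall z, QW W true true z = 0} ->
  {ae (mu \x mu)%E, forall z, QW W false false z = 0} ->
  [/\ lim_density Gamma (edges C1) = 0, lim_density Gamma (edges C2) = 0 &
      lim_density Gamma (edges E2) = 0].
Proof.
move=> w0 W11 W00.
have Wb0 b (H : edge_set 2) : (forall i, (i, i) \notin H) ->
    (forall i j, i != j -> ((i, j) \in H) = b) ->
    {ae (mu \x mu)%E, forall z, QW W b b z = 0} -> lim_density Gamma H = 0.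
  move=> Hl Hb Wb; apply: EFin_inj; rewrite -(integral_QW_loopless Hl Hb).
  apply: ae0_integral; first exact: measurable_loopless_pair.
  - exact: loopless_pair_ge0.
  - by apply: filterS Wb => z Wz; rewrite /loopless_pair Wz mul0r.
split.
- apply: EFin_inj; rewrite -integral_Qw; apply: ae0_integral => //.
    exact: Qw_measurable.
  by move=> x; have /andP[] := Qw_01 W x.
- apply: Wb0 W11 => [i|i j ij].
    by rewrite !inE; case: i => -[|[|//]] p.
  by rewrite !inE; case: i j ij => [[|[|//]] p] [[|[|//]] q].
- by apply: Wb0 W00 => [i|i j ij]; rewrite inE.
Qed.

End Represented.

(** * Counting lemma *)

Section Counting.
Context (R : realFieldType) (I V : finType).

Definition endpoint (p : I * I) (b : bool) : I := if b then p.1 else p.2.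

Lemma endpoint_inj p : p.1 != p.2 -> injective (endpoint p).
Proof.
by move=> p12 [] [] //= e; move: p12; rewrite -?e ?eqxx // e eqxx.
Qed.

Definition in01 (T : Type) (f : T -> R) := forall x, 0 <= f x <= 1.

(* Once the values of [f] off the two endpoints of [p] are fixed, [X] is a
   product of a function of [f p.1] and a function of [f p.2]. *)
Definition splits (p : I * I) (X : {ffun I -> V} -> R) := forall f,
  exists phi psi : V -> R, [/\ in01 phi, in01 psi & forall g : {ffun bool -> V},
    X (overwrite (endpoint p) f g) = phi (g true) * psi (g false)].

Lemma in01M (T : Type) (f g : T -> R) :
  in01 f -> in01 g -> in01 (fun x => f x * g x).
Proof.
move=> f01 g01 x; have /andP[f0 f1] := f01 x; have /andP[g0 g1] := g01 x.
by rewrite mulr_ge0//= mulr_ile1.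
Qed.

Lemma splits1 p : splits p (fun=> 1).
Proof.
move=> f; exists (fun=> 1), (fun=> 1).
by split=> [x|x|g]; rewrite ?mulr1// ler01 lexx.
Qed.

Lemma splitsM p X Y : splits p X -> splits p Y -> splits p (fun f => X f * Y f).
Proof.
move=> Xs Ys f; have [a [b [a01 b01 ab]]] := Xs f.
have [a' [b' [a'01 b'01 ab']]] := Ys f.
exists (fun u => a u * a' u), (fun v => b v * b' v).
by split=> [||g]; [exact: in01M|exact: in01M|rewrite ab ab' mulrACA].
Qed.

Lemma splits_prod p (J : Type) (r : seq J) (P : pred J)
    (X : J -> {ffun I -> V} -> R) : (forall j, P j -> splits p (X j)) ->
  splits p (fun f => \prod_(j <- r | P j) X j f).
Proof.
move=> Xs; elim: r => [|j r IH].
  rewrite (_ : (fun f => _) = fun=> 1); first exact: splits1.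
  by apply/funext => f; rewrite big_nil.
rewrite (_ : (fun f => _) = fun f => (if P j then X j f else 1) *
    \prod_(j <- r | P j) X j f); last first.
  by apply/funext => f; rewrite big_cons; case: ifP => // _; rewrite mul1r.
by apply: splitsM => //; case: (P j) (Xs j) => [/(_ isT)//|_]; exact: splits1.
Qed.

(** A pair [q] that is neither [p] nor its reversal contains at most one end of [p], so its factor
    reads at most one resampled value. *)
Lemma splits_edge p q (K : V -> V -> R) : p.1 != p.2 ->
  (p != q) && (p != (q.2, q.1)) -> (forall u v, 0 <= K u v <= 1) ->
  splits p (fun f => K (f q.1) (f q.2)).
Proof.
case: p q => [p1 p2] [q1 q2] /= p12 pq K01 f.
(* [C v] writes [v] at both ends of [p]; this is harmless, as at most one of them is read. *)
pose C (v : V) : {ffun bool -> V} := [ffun _ : bool => v].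
pose X (f : {ffun I -> V}) : R := K (f q1) (f q2).
have X01 f' : 0 <= X f' <= 1 by exact: K01.
have owE g i : overwrite (endpoint (p1, p2)) f g i =
    if i == p1 then g true else if i == p2 then g false else f i.
  have inj := @endpoint_inj (p1, p2) p12.
  have [->|ip1] := eqVneq i p1; first exact: (overwrite_in inj f g true).
  have [->|ip2] := eqVneq i p2; first exact: (overwrite_in inj f g false).
  by rewrite overwrite_out// => -[]; rewrite eq_sym.
have [n1|] := boolP ((q1 != p1) && (q2 != p1)).
  exists (fun=> 1), (fun v => X (overwrite (endpoint (p1, p2)) f (C v))).
  split=> [x|x|g]; [by rewrite ler01 lexx|exact: X01|].
  move/andP: n1 => [/negPf n1 /negPf n2].
  by rewrite mul1r /X !owE n1 n2 !ffunE.
rewrite negb_and !negbK => e1.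
have n2 : (q1 != p2) && (q2 != p2).
  case/orP: e1 => /eqP e; subst p1; rewrite ?p12 ?andbT//=.
    by apply/negP => /eqP e; subst p2; move: pq; rewrite eqxx.
  by apply/negP => /eqP e; subst p2; move: pq; rewrite eqxx andbF.
exists (fun v => X (overwrite (endpoint (p1, p2)) f (C v))), (fun=> 1).
split=> [x|x|g]; [exact: X01|by rewrite ler01 lexx|].
move/andP: n2 => [/negPf n1 /negPf n2].
by rewrite mulr1 /X !owE n1 n2 !ffunE.
Qed.

Lemma splits_vertex p i (L : V -> R) : p.1 != p.2 -> in01 L ->
  splits p (fun f => L (f i)).
Proof.
move=> p12 L01 f; have inj := endpoint_inj p12.
have [->|ip1] := eqVneq i p.1.
  exists L, (fun=> 1); split=> [//|x|g]; first by rewrite ler01 lexx.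
  by rewrite mulr1 (overwrite_in inj f g true).
have [->|ip2] := eqVneq i p.2.
  exists (fun=> 1), L; split=> [x|//|g]; first by rewrite ler01 lexx.
  by rewrite mul1r (overwrite_in inj f g false).
exists (fun=> 1), (fun=> L (f i)).
split=> [x|x|g]; [by rewrite ler01 lexx|exact: L01|].
by rewrite mul1r overwrite_out// => -[]; rewrite eq_sym.
Qed.

Lemma sum_ffun_bool (X : V -> V -> R) :
  \sum_(g : {ffun bool -> V}) X (g true) (g false) = \sum_u \sum_v X u v.
Proof.
rewrite pair_bigA/= (reindex (fun uv : V * V =>
  [ffun b : bool => if b then uv.1 else uv.2])).
  by apply: eq_bigr => uv _; rewrite !ffunE.
exists (fun g : {ffun bool -> V} => (g true, g false)) => [[u v] _|g _].
  by rewrite !ffunE.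
by apply/ffunP => -[]; rewrite ffunE.
Qed.

(** [delta] bounds the cut norm of [B]. Once both ends of [p] are resampled with the other
    coordinates fixed, [X] is a product [phi u * psi v], which the cut norm controls; [#|V| ^ 2]
    counts the resampled values. *)
Lemma counting_step p (B : V -> V -> R) (X : {ffun I -> V} -> R) (delta : R) :
  p.1 != p.2 -> splits p X ->
  (forall phi psi : V -> R, in01 phi -> in01 psi ->
    `|\sum_u \sum_v B u v * (phi u * psi v)| <= delta) ->
  `|\sum_(f : {ffun I -> V}) B (f p.1) (f p.2) * X f| * (#|V| ^ 2)%:R <=
  delta * (#|V| ^ #|I|)%:R.
Proof.
move=> p12 Xs Bd; have inj := endpoint_inj p12.
have E : (\sum_(f : {ffun I -> V}) B (f p.1) (f p.2) * X f) *+ (#|V| ^ 2) =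
    \sum_(f : {ffun I -> V}) \sum_(g : {ffun bool -> V})
      B (overwrite (endpoint p) f g p.1) (overwrite (endpoint p) f g p.2) *
      X (overwrite (endpoint p) f g).
  rewrite -card_bool; apply/esym.
  have := sum_overwrite inj (fun f : {ffun I -> V} => B (f p.1) (f p.2) * X f).
  exact.
rewrite -[X in _ * X <= _]ger0_norm ?ler0n// -normrM [X in `|X|]mulr_natr E.
rewrite -card_ffun -[#|_|]sum1_card natr_sum mulr_sumr.
apply: (le_trans (ler_norm_sum _ _ _)); apply: ler_sum => f _.
have [phi [psi [phi01 psi01 XE]]] := Xs f; rewrite mulr1.
under eq_bigr => g _ do
  rewrite XE (overwrite_in inj f g true) (overwrite_in inj f g false).
by rewrite (sum_ffun_bool (fun u v => B u v * (phi u * psi v))); exact: Bd.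
Qed.

(* The kernels are replaced one pair at a time; the remaining factors split. *)
Lemma counting (r : seq (I * I)) (K K' : I * I -> V -> V -> R)
    (Y : {ffun I -> V} -> R) (delta : R) :
  uniq r -> (forall p, p \in r -> p.1 != p.2) ->
  (forall p q, p \in r -> q \in r -> p != (q.2, q.1)) ->
  (forall p u v, 0 <= K p u v <= 1) -> (forall p u v, 0 <= K' p u v <= 1) ->
  (forall p, p \in r -> splits p Y) ->
  (forall p phi psi, in01 phi -> in01 psi ->
    `|\sum_u \sum_v (K p u v - K' p u v) * (phi u * psi v)| <= delta) ->
  `|\sum_(f : {ffun I -> V}) (\prod_(p <- r) K p (f p.1) (f p.2)) * Y f -
    \sum_(f : {ffun I -> V}) (\prod_(p <- r) K' p (f p.1) (f p.2)) * Y f| *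
    (#|V| ^ 2)%:R <=
  (size r)%:R * (delta * (#|V| ^ #|I|)%:R).
Proof.
move=> + + + K01 K'01 + Kd.
elim: r Y => [|p r IH] Y.
  move=> _ _ _ _; rewrite mul0r.
  under eq_bigr do rewrite big_nil.
  by under [X in _ - X]eq_bigr do rewrite big_nil; rewrite subrr normr0 mul0r.
move=> /=/andP[pr ur] d12 dsw Ysp.
have p12 : p.1 != p.2 by apply: d12; rewrite mem_head.
have sub q : q \in r -> q \in p :: r by move=> qr; rewrite inE qr orbT.
have step : `|\sum_(f : {ffun I -> V})
      (K p (f p.1) (f p.2) - K' p (f p.1) (f p.2)) *
      ((\prod_(q <- r) K q (f q.1) (f q.2)) * Y f)| * (#|V| ^ 2)%:R <=
    delta * (#|V| ^ #|I|)%:R.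
  apply: (@counting_step p (fun u v => K p u v - K' p u v)) => //; last exact: Kd.
  apply: splitsM; last by apply: Ysp; rewrite mem_head.
  rewrite (_ : (fun f => _) = fun f : {ffun I -> V} =>
      \prod_(q <- r | q \in r) K q (f q.1) (f q.2)).
    apply: splits_prod => q qr; apply: splits_edge => //.
    rewrite (dsw p q) ?mem_head ?sub// andbT.
    by apply: contra pr => /eqP ->.
  by apply/funext => f; rewrite big_seq.
(* [K' p], already exchanged, joins [Y] for the remaining pairs, along which it splits as well. *)
have rest : `|\sum_(f : {ffun I -> V}) (\prod_(q <- r) K q (f q.1) (f q.2)) *
        (K' p (f p.1) (f p.2) * Y f) -
      \sum_(f : {ffun I -> V}) (\prod_(q <- r) K' q (f q.1) (f q.2)) *
        (K' p (f p.1) (f p.2) * Y f)| * (#|V| ^ 2)%:R <=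
    (size r)%:R * (delta * (#|V| ^ #|I|)%:R).
  apply: IH => //.
  - by move=> q qr; apply: d12; exact: sub.
  - by move=> q q' qr q'r; apply: dsw; exact: sub.
  - move=> q qr; apply: splitsM; last by apply: Ysp; exact: sub.
    apply: splits_edge => //; first by apply: d12; exact: sub.
    rewrite (dsw q p) ?mem_head ?sub// andbT.
    by apply: contra pr => /eqP <-.
rewrite -natr1 mulrDl mul1r; apply: le_trans (lerD rest step).
rewrite -mulrDl ler_wpM2r//; apply: le_trans (ler_normD _ _).
rewrite le_eqVlt; apply/orP; left; apply/eqP; congr (`|_|).
rewrite -!sumrB -big_split/=; apply: eq_bigr => f _.
by rewrite !big_cons; ring.
Qed.

End Counting.

(** * Weak regularity *)

Section Averaging.
Context (R : realFieldType) (V : finType) (T : eqType) (tau : V -> T).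

(** The conditional expectation of [g] at a uniform vertex, given its label; on an empty block the
    quotient by 0 makes it 0. *)
Definition block_average (g : V -> R) (w : T) : R :=
  (\sum_(v | tau v == w) g v) / #|[pred v | tau v == w]|%:R.

Lemma block_average01 g w : in01 g -> 0 <= block_average g w <= 1.
Proof.
move=> g01; have g0 v : 0 <= g v by have /andP[] := g01 v.
rewrite /block_average divr_ge0 ?sumr_ge0//=.
have [->|b0] := eqVneq #|[pred v | tau v == w]| 0%N.
  by rewrite invr0 mulr0 ler01.
rewrite ler_pdivrMr ?ltr0n ?lt0n// mul1r -sum1_card natr_sum.
by apply: ler_sum => v _; have /andP[] := g01 v.
Qed.

Lemma block_average_proj g (h : T -> R) :
  \sum_v block_average g (tau v) * h (tau v) = \sum_v g v * h (tau v).
Proof.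
rewrite /block_average.
under eq_bigr => v _ do rewrite mulrAC -mulrA mulr_suml.
rewrite (exchange_big_dep predT)//=; apply: eq_bigr => v' _.
rewrite (eq_bigr (fun=> g v' * (h (tau v') / #|[pred v | tau v == tau v']|%:R))).
  rewrite sumr_const -[LHS]mulr_natr -mulrA; congr *%R.
  rewrite (eq_card (B := [pred v | tau v == tau v'])); last first.
    by move=> v; rewrite !inE eq_sym.
  rewrite divfK// pnatr_eq0 -lt0n; apply/card_gt0P; exists v'.
  by rewrite inE.
by move=> v /eqP ->.
Qed.

Definition block_density (A : V -> V -> R) (w w' : T) : R :=
  block_average (fun v => block_average (A^~ v) w) w'.

Lemma block_density01 A w w' : (forall u v, 0 <= A u v <= 1) ->
  0 <= block_density A w w' <= 1.
Proof. by move=> A01; do 2![apply: block_average01 => ?]. Qed.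

Lemma block_density_proj A (h : T -> T -> R) :
  \sum_u \sum_v block_density A (tau u) (tau v) * h (tau u) (tau v) =
  \sum_u \sum_v A u v * h (tau u) (tau v).
Proof.
under eq_bigr => u _ do rewrite block_average_proj.
rewrite exchange_big [RHS]exchange_big; apply: eq_bigr => v _.
exact: (block_average_proj (A^~ v) (h^~ (tau v))).
Qed.

End Averaging.

Lemma sqr_sum_le (R : realFieldType) (I : finType) (x : I -> R) :
  (\sum_i x i) ^+ 2 <= #|I|%:R * \sum_i x i ^+ 2.
Proof.
set S := \sum_i x i; set Q := \sum_i x i ^+ 2; set n : R := #|I|%:R.
have [n0|n0] := eqVneq #|I| 0%N.
  have x0 : S = 0.
    by rewrite /S big_pred0// => i; have := card0_eq n0 i; rewrite inE.
  by rewrite x0 expr0n mulr_ge0 ?ler0n// sumr_ge0// => i _; exact: sqr_ge0.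
have n_gt0 : 0 < n by rewrite ltr0n lt0n.
(* Cauchy-Schwarz from the nonnegativity of the variance of [x], scaled to clear denominators. *)
have : 0 <= \sum_i (n * x i - S) ^+ 2 by apply: sumr_ge0 => i _; exact: sqr_ge0.
have -> : \sum_i (n * x i - S) ^+ 2 = n * (n * Q - S ^+ 2).
  transitivity (\sum_i (n ^+ 2 * x i ^+ 2 - (2 * n * S) * x i + S ^+ 2)).
    by apply: eq_bigr => i _; ring.
  rewrite big_split sumrB/= -!mulr_sumr sumr_const -/S -/Q -[_ *+ _]mulr_natr -/n.
  by ring.
by rewrite pmulr_rge0// subr_ge0.
Qed.

Section Energy.
Context (R : realFieldType) (V C : finType) (A : C -> V -> V -> R).

Definition energy (T : eqType) (tau : V -> T) : R :=
  \sum_c \sum_u \sum_v block_density tau (A c) (tau u) (tau v) ^+ 2.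

(** Pythagoras: both densities are projections of [A c], the coarse one also of the fine one, so the
    cross term equals the coarse energy. *)
Lemma energy_refine (T T' : eqType) (tau : V -> T) (tau' : V -> T')
    (rho : T' -> T) : (forall v, tau v = rho (tau' v)) ->
  energy tau' - energy tau = \sum_c \sum_u \sum_v
    (block_density tau' (A c) (tau' u) (tau' v) -
     block_density tau (A c) (tau u) (tau v)) ^+ 2.
Proof.
move=> tauE; rewrite /energy -sumrB; apply: eq_bigr => c _.
set D' := block_density tau' (A c); set D := block_density tau (A c).
have E : \sum_u \sum_v D' (tau' u) (tau' v) * D (tau u) (tau v) =
    \sum_u \sum_v D (tau u) (tau v) ^+ 2.
  transitivity (\sum_u \sum_v A c u v * D (tau u) (tau v)).
    under [RHS]eq_bigr => u _ do under eq_bigr => v _ do rewrite !tauE.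
    rewrite -[RHS](block_density_proj tau' (A c) (fun w w' => D (rho w) (rho w'))).
    by under [RHS]eq_bigr => u _ do under eq_bigr => v _ do rewrite -!tauE.
  by rewrite -(block_density_proj tau (A c) D).
transitivity (\sum_u \sum_v D' (tau' u) (tau' v) ^+ 2 +
  \sum_u \sum_v D (tau u) (tau v) ^+ 2 -
  (\sum_u \sum_v D' (tau' u) (tau' v) * D (tau u) (tau v)) *+ 2).
  by rewrite E; ring.
rewrite -sumrMnl -big_split -sumrB/=; apply: eq_bigr => u _.
rewrite -sumrMnl -big_split -sumrB/=; apply: eq_bigr => v _.
by ring.
Qed.

(** Its maximal absolute value over [in01] functions is the unnormalized cut norm of [A c] minus its
    block averages. *)
Definition discrepancy (T : eqType) (tau : V -> T) (c : C) (phi psi : V -> R) : R :=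
  \sum_u \sum_v (A c u v - block_density tau (A c) (tau u) (tau v)) *
    (phi u * psi v).

(** The test sets are unions of blocks of [tau'], so [A c] may be replaced by its averages over
    these blocks. Cauchy-Schwarz then bounds the square by the part of colour [c] in
    [energy_refine]. *)
Lemma energy_increment (T T' : eqType) (tau : V -> T) (tau' : V -> T')
    (rho : T' -> T) (F G : T' -> bool) c : (forall v, tau v = rho (tau' v)) ->
  discrepancy tau c (fun v => (F (tau' v))%:R) (fun v => (G (tau' v))%:R) ^+ 2 <=
  (#|V| ^ 2)%:R * (energy tau' - energy tau).
Proof.
move=> tauE; rewrite (energy_refine tauE) (bigD1 c)//=.
set D' := block_density tau' (A c); set D := block_density tau (A c).
have -> : discrepancy tau c (fun v => (F (tau' v))%:R) (fun v => (G (tau' v))%:R) =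
    \sum_u \sum_v (D' (tau' u) (tau' v) - D (tau u) (tau v)) *
      ((F (tau' u))%:R * (G (tau' v))%:R).
  under [RHS]eq_bigr => u _ do (under eq_bigr => v _ do rewrite mulrBl;
    rewrite sumrB).
  rewrite sumrB (block_density_proj tau' (A c) (fun w w' => (F w)%:R * (G w')%:R)).
  rewrite -sumrB; apply: eq_bigr => u _; rewrite -sumrB; apply: eq_bigr => v _.
  by rewrite mulrBl.
rewrite pair_bigA/=; apply: (le_trans (sqr_sum_le _)).
rewrite card_prod -[(#|V| * #|V|)%N]/(#|V| ^ 2)%N ler_wpM2l//.
rewrite -(pair_bigA _ (fun u v => ((D' (tau' u) (tau' v) - D (tau u) (tau v)) *
      ((F (tau' u))%:R * (G (tau' v))%:R)) ^+ 2))/=.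
rewrite -[leLHS]addr0 lerD//; last first.
  by do 3![apply: sumr_ge0 => ? _]; exact: sqr_ge0.
apply: ler_sum => u _; apply: ler_sum => v _.
rewrite exprMn -[leRHS]mulr1 ler_wpM2l ?sqr_ge0//.
by case: (F _); case: (G _); rewrite ?mulr0 ?mul0r ?expr0n ?mulr1 ?expr1n ?ler01.
Qed.

(** For fixed [psi] the form is linear in [phi], hence maximal at the indicator of the nonnegative
    coefficients; then likewise in [psi]. The sign [s] gives both bounds on the absolute value. *)
Lemma discrepancy_bool (T : eqType) (tau : V -> T) c (phi psi : V -> R)
    (delta : R) :
  (forall f g : {ffun V -> bool},
    `|discrepancy tau c (fun v => (f v)%:R) (fun v => (g v)%:R)| <= delta) ->
  in01 phi -> in01 psi -> `|discrepancy tau c phi psi| <= delta.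
Proof.
move=> bd phi01 psi01.
set B := fun u v => A c u v - block_density tau (A c) (tau u) (tau v).
have lin1 (x : V -> R) (a : V -> R) : in01 a ->
    \sum_u x u * a u <= \sum_u x u * (0 <= x u)%R%:R.
  move=> a01; apply: ler_sum => u _; have /andP[a0 a1] := a01 u.
  have [x0|x0] := lerP 0 (x u); first by rewrite mulr1 ler_piMr.
  by rewrite mulr0 mulr_le0_ge0// ltW.
have ub (phi' psi' : V -> R) (s : R) : in01 phi' -> in01 psi' ->
   exists f g : {ffun V -> bool}, s * discrepancy tau c phi' psi' <=
     s * discrepancy tau c (fun v => (f v)%:R) (fun v => (g v)%:R).
  move=> p01 q01.
  pose f : {ffun V -> bool} := [ffun u => 0 <= \sum_v s * B u v * psi' v].
  pose g : {ffun V -> bool} := [ffun v => 0 <= \sum_u s * B u v * (f u)%:R].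
  have E (a b : V -> R) : s * discrepancy tau c a b =
      \sum_u (\sum_v s * B u v * b v) * a u.
    rewrite /discrepancy mulr_sumr; apply: eq_bigr => u _.
    rewrite mulr_sumr mulr_suml; apply: eq_bigr => v _.
    by rewrite /B; ring.
  have E' (a b : V -> R) : s * discrepancy tau c a b =
      \sum_v (\sum_u s * B u v * a u) * b v.
    rewrite E; under eq_bigr do rewrite mulr_suml.
    rewrite exchange_big; apply: eq_bigr => v _; rewrite mulr_suml.
    by apply: eq_bigr => u _; ring.
  exists f, g.
  apply: (@le_trans _ _ (s * discrepancy tau c (fun v => (f v)%:R) psi')).
    rewrite !E; apply: (le_trans (lin1 _ _ p01)).
    by apply: ler_sum => u _; rewrite /f ffunE.
  rewrite !E'; apply: (le_trans (lin1 _ _ q01)).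
  by apply: ler_sum => u _; rewrite /g ffunE.
rewrite ler_norml; apply/andP; split.
- have [f [g]] := ub phi psi (-1) phi01 psi01; rewrite !mulN1r lerN2.
  by apply: le_trans; have := bd f g; rewrite ler_norml => /andP[].
- have [f [g]] := ub phi psi 1 phi01 psi01; rewrite !mul1r.
  by move=> /le_trans; apply; have := bd f g; rewrite ler_norml => /andP[].
Qed.

End Energy.

Local Notation letter := (bool * bool)%type.

Section Refinement.
Context (R : realFieldType) (V C : finType) (c0 : C) (A : C -> V -> V -> R).
Variable loop : V -> bool.

(* A pair of vertex sets on which the adjacency deviates the most from its block
   averages, together with the colour for which it does. *)
Definition witness (tau : V -> seq letter) :
    C * ({ffun V -> bool} * {ffun V -> bool}) :=
  [arg max_(p > (c0, ([ffun=> false], [ffun=> false])))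
    `|discrepancy A tau p.1 (fun v => (p.2.1 v)%:R) (fun v => (p.2.2 v)%:R)|]%O.

(* The first letter ever added (the last one of the word) records the loop; each
   further one records the membership in the two sets of a worst witness. *)
Fixpoint types (m : nat) (v : V) : seq letter :=
  match m with
  | 0 => [::]
  | 1 => [:: (loop v, loop v)]
  | m'.+1 => let p := witness (types m') in (p.2.1 v, p.2.2 v) :: types m' v
  end.

Lemma size_types m v : size (types m v) = m.
Proof. by elim: m => // -[|m]//= ->. Qed.

Lemma behead_types m v : behead (types m.+1 v) = types m v.
Proof. by case: m. Qed.

Lemma last_types m v : last (false, false) (types m.+1 v) = (loop v, loop v).
Proof. by elim: m => //= -[|m]. Qed.

(** The level starts at [m.+1] because the letter added to the empty word records the loop and no
    witness. *)
Lemma types_discrepancy m c phi psi : in01 phi -> in01 psi ->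
  discrepancy A (types m.+1) c phi psi ^+ 2 <=
  (#|V| ^ 2)%:R * (energy A (types m.+2) - energy A (types m.+1)).
Proof.
move=> phi01 psi01; set p := witness (types m.+1).
pose delta := `|discrepancy A (types m.+1) p.1
  (fun v => (p.2.1 v)%:R) (fun v => (p.2.2 v)%:R)|.
have : `|discrepancy A (types m.+1) c phi psi| <= delta.
  apply: discrepancy_bool => // f g.
  rewrite /delta /p /witness; case: Order.TotalTheory.arg_maxP => //= q _ qmax.
  exact: (qmax (c, (f, g))).
rewrite -(ler_sqr (normr_nneg _) (normr_nneg _)) ?nnegrE//.
rewrite !real_normK ?num_real// => /le_trans; apply.
(* The two indicators of the witness are the components of the letter just added, hence functions of
   the finer type. *)
apply: (@energy_increment _ _ _ _ _ _ _ (types m.+2) behead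
  (fun w => (head (false, false) w).1) (fun w => (head (false, false) w).2)).
by move=> v; rewrite behead_types.
Qed.

Lemma energy_types_homo :
  {homo (fun m => energy A (types m)) : m n / (m <= n)%N >-> m <= n}.
Proof.
apply: homo_leq => //; first by move=> a b c; exact: le_trans.
move=> m; rewrite -subr_ge0 (energy_refine _ (rho := behead)).
  by do 3![apply: sumr_ge0 => ? _]; exact: sqr_ge0.
by move=> v; rewrite behead_types.
Qed.

End Refinement.

Arguments types : simpl never.

(** * Weights, densities and energies indexed by words *)

Section Words.
Context (R : realType).

Definition loop_letter (w : seq letter) : R := (last (false, false) w).1%:R.

(** The probability of [H] under sampling from a step quintuple: the points are the words of length
    [m], with law [s] and kernel [D], and the last letter decides the loop. *)
Definition word_density (s : seq letter -> R)
    (D : bool -> bool -> seq letter * seq letter -> R) m k (H : edge_set k) : R :=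
  \sum_(ws : {ffun 'I_k -> m.-tuple letter}) (\prod_i s (ws i)) *
    kernel_pmf D loop_letter [tuple val (ws i) | i < k] H.

Definition word_energy (s : seq letter -> R)
    (D : bool -> bool -> seq letter * seq letter -> R) m : R :=
  \sum_(c : bool * bool) \sum_(w : m.-tuple letter) \sum_(w' : m.-tuple letter)
    s w * s w' * D c.1 c.2 (val w, val w') ^+ 2.

End Words.

Section DigraphWords.
Context (R : realType) (G : digraph).
Hypothesis G_gt0 : (0 < vnum G)%N.
Local Notation V := 'I_(vnum G).

Definition adjacency (c : bool * bool) (u v : V) : R :=
  ((((u, v) \in edges G) == c.1) && (((v, u) \in edges G) == c.2))%:R.

Definition vertex_type (m : nat) (v : V) : seq letter :=
  types (false, false) adjacency (fun v => (v, v) \in edges G) m v.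

Definition word_weight (w : seq letter) : R :=
  #|[pred v | vertex_type (size w) v == w]|%:R / (vnum G)%:R.

(** The level is read off the first word, so the value has the intended meaning only for two words
    of equal length. *)
Definition word_adjacency (a b : bool) (z : seq letter * seq letter) : R :=
  block_density (vertex_type (size z.1)) (adjacency (a, b)) z.1 z.2.

Let N0 : (vnum G)%:R != 0 :> R.
Proof. by rewrite pnatr_eq0 -lt0n. Qed.

Lemma adjacency01 c u v : 0 <= adjacency c u v <= 1.
Proof. by rewrite ler0n lern1 leq_b1. Qed.

Lemma size_vertex_type m v : size (vertex_type m v) = m.
Proof. exact: size_types. Qed.

Definition vertex_tuple m v : m.-tuple letter :=
  Tuple (introT eqP (size_vertex_type m v)).

Lemma word_weightE m (w : m.-tuple letter) :
  word_weight w = (\sum_v (vertex_tuple m v == w)%:R) / (vnum G)%:R.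
Proof.
rewrite /word_weight size_tuple -sum1_card natr_sum big_mkcond/=.
by congr (_ / _); apply: eq_bigr => v _; rewrite inE -val_eqE/=; case: eqP.
Qed.

Lemma word_weight_ge0 w : 0 <= word_weight w.
Proof. by rewrite divr_ge0. Qed.

Lemma word_weight_le1 w : word_weight w <= 1.
Proof.
rewrite ler_pdivrMr ?ltr0n// mul1r ler_nat.
by rewrite -[leqRHS]card_ord max_card.
Qed.

(** [word_weight] is the law of the type of a uniform vertex; this lemma and the next two turn sums
    over words into sums over vertices. *)
Lemma sum_word_weight m (h : seq letter -> R) :
  \sum_(w : m.-tuple letter) word_weight w * h w =
  (\sum_v h (vertex_type m v)) / (vnum G)%:R.
Proof.
under eq_bigr do rewrite word_weightE mulrAC.
rewrite -mulr_suml; congr (_ / _).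
under eq_bigr do rewrite mulr_suml.
rewrite exchange_big/=; apply: eq_bigr => v _.
rewrite (bigD1 (vertex_tuple m v))//= eqxx mul1r big1 ?addr0// => w.
by rewrite eq_sym => /negPf ->; rewrite mul0r.
Qed.

Lemma sum2_word_weight m (h : seq letter -> seq letter -> R) :
  \sum_(w : m.-tuple letter) \sum_(w' : m.-tuple letter)
    word_weight w * word_weight w' * h w w' =
  (\sum_u \sum_v h (vertex_type m u) (vertex_type m v)) / (vnum G ^ 2)%:R.
Proof.
transitivity (\sum_(w : m.-tuple letter) word_weight w *
    (\sum_(w' : m.-tuple letter) word_weight w' * h w w')).
  apply: eq_bigr => w _; rewrite mulr_sumr.
  by apply: eq_bigr => w' _; rewrite mulrA.
under eq_bigr do rewrite sum_word_weight.
rewrite (sum_word_weight m (fun w => (\sum_v h w (vertex_type m v)) / (vnum G)%:R)).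
by rewrite -mulr_suml natrX expr2 invfM mulrA.
Qed.

Lemma sum_tuple_word_weight m k (X : k.-tuple (seq letter) -> R) :
  \sum_(ws : {ffun 'I_k -> m.-tuple letter}) (\prod_i word_weight (ws i)) *
    X [tuple val (ws i) | i < k] =
  (\sum_(f : {ffun 'I_k -> V}) X [tuple vertex_type m (f i) | i < k]) /
    (vnum G ^ k)%:R.
Proof.
have E (ws : {ffun 'I_k -> m.-tuple letter}) : \prod_i word_weight (ws i) =
    (\sum_(f : {ffun 'I_k -> V}) (\prod_i (vertex_tuple m (f i) == ws i)%:R)) /
      (vnum G ^ k)%:R.
  under eq_bigr do rewrite word_weightE.
  rewrite big_split/= prodr_const card_ord exprVn natrX; congr (_ / _).
  by rewrite bigA_distr_bigA.
under eq_bigr do rewrite E mulrAC.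
rewrite -mulr_suml; congr (_ / _).
under eq_bigr do rewrite mulr_suml.
rewrite exchange_big/=; apply: eq_bigr => f _.
rewrite (bigD1 [ffun i => vertex_tuple m (f i)])//= big1 ?mul1r; last first.
  by move=> i _; rewrite ffunE eqxx.
rewrite big1 ?addr0 => [|ws wsf].
  by congr X; apply: eq_from_tnth => i; rewrite !tnth_mktuple ffunE.
rewrite (_ : \prod_i _ = 0) ?mul0r//.
have /existsP[i fi] : [exists i, vertex_tuple m (f i) != ws i].
  apply: contraR wsf; rewrite negb_exists => /forallP wsf.
  by apply/eqP/ffunP => i; rewrite ffunE; apply/esym/eqP; rewrite -[_ == _]negbK.
by rewrite (bigD1 i)//= (negPf fi) mul0r.
Qed.

Lemma word_weight_nil : word_weight [::] = 1.
Proof.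
rewrite /word_weight/= (eq_card (B := predT)) ?card_ord ?divff//.
Qed.

Lemma word_weight_cons w : word_weight w = \sum_(l : letter) word_weight (l :: w).
Proof.
rewrite /word_weight -mulr_suml -natr_sum; congr (_%:R / _).
rewrite -sum1_card (partition_big
  (fun v => head (false, false) (vertex_type (size w).+1 v)) predT)//=.
apply: eq_bigr => l _; rewrite -sum1_card; apply: eq_bigl => v; rewrite !inE.
have hb : behead (vertex_type (size w).+1 v) = vertex_type (size w) v.
  exact: behead_types.
have hs := size_vertex_type (size w).+1 v.
rewrite -hb; move: {hb} (vertex_type _ v) hs.
move=> [//|l' w'] _.
by rewrite eqseq_cons andbC.
Qed.

Lemma word_adjacency01 a b z : 0 <= word_adjacency a b z <= 1.
Proof. exact: block_density01 (adjacency01 (a, b)). Qed.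

Lemma word_adjacency_sym a b w w' : size w = size w' ->
  word_adjacency a b (w, w') = word_adjacency b a (w', w).
Proof.
move=> ww'; rewrite /word_adjacency/= /block_density /block_average -ww'.
rewrite -!mulr_suml -!mulrA [in RHS](mulrC _^-1); congr (_ * _).
rewrite exchange_big/=; apply: eq_bigr => u _; apply: eq_bigr => v _.
by rewrite /adjacency/= andbC.
Qed.

Lemma word_adjacency_proj m a b (h : seq letter -> seq letter -> R) :
  \sum_(w : m.-tuple letter) \sum_(w' : m.-tuple letter)
    word_weight w * word_weight w' * (word_adjacency a b (val w, val w') * h w w') =
  (\sum_u \sum_v adjacency (a, b) u v * h (vertex_type m u) (vertex_type m v)) /
    (vnum G ^ 2)%:R.
Proof.
rewrite (sum2_word_weight m (fun w w' => word_adjacency a b (w, w') * h w w')).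
congr (_ / _); rewrite -(block_density_proj (vertex_type m) (adjacency (a, b)) h).
apply: eq_bigr => u _; apply: eq_bigr => v _; rewrite /word_adjacency/=.
by rewrite size_vertex_type.
Qed.

(** Both sides integrate [adjacency] against the same function of the coarse types. The tower
    property is tested against [h], instead of block by block, so that no weight becomes a
    denominator. *)
Lemma word_adjacency_martingale m a b (h : seq letter -> seq letter -> R) :
  \sum_(w : m.+1.-tuple letter) \sum_(w' : m.+1.-tuple letter)
    word_weight w * word_weight w' *
    (word_adjacency a b (val w, val w') * h (behead w) (behead w')) =
  \sum_(w : m.-tuple letter) \sum_(w' : m.-tuple letter)
    word_weight w * word_weight w' * (word_adjacency a b (val w, val w') * h w w').
Proof.
rewrite word_adjacency_proj.
rewrite (word_adjacency_proj m.+1 a b (fun w w' => h (behead w) (behead w'))).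
congr (_ / _); apply: eq_bigr => u _; apply: eq_bigr => v _.
by rewrite !behead_types.
Qed.

(** The weights stay as factors because on an empty block all four densities are 0, with sum 0
    instead of 1. *)
Lemma word_adjacency_sum w w' : size w = size w' ->
  word_weight w * word_weight w' *
  (\sum_(c : bool * bool) word_adjacency c.1 c.2 (w, w')) =
  word_weight w * word_weight w'.
Proof.
move=> ww'; rewrite /word_adjacency/= /block_density/= /block_average.
have [w0|w0] := eqVneq #|[pred v | vertex_type (size w) v == w]| 0%N.
  by rewrite /word_weight w0 !mul0r.
have [w'0|w'0] := eqVneq #|[pred v | vertex_type (size w') v == w']| 0%N.
  by rewrite /word_weight w'0 mul0r !mulr0 mul0r.
rewrite -[RHS]mulr1; congr (_ * _).
rewrite -mulr_suml exchange_big/=.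
under eq_bigr => v _.
  rewrite -mulr_suml exchange_big/=.
  under eq_bigr => u _.
    rewrite (_ : \sum_i _ = 1); last first.
      rewrite (bigD1 ((u, v) \in edges G, (v, u) \in edges G))//= big1 => [|[a b]].
        by rewrite addr0 /adjacency/= !eqxx.
      rewrite xpair_eqE negb_and /adjacency/= ![_ == (_ \in _)]eq_sym.
      move=> /orP[|] /negPf ->//.
      by rewrite andbF.
    over.
  rewrite sumr_const divff ?pnatr_eq0//.
  over.
by rewrite sumr_const divff// pnatr_eq0 ww'.
Qed.

Lemma energy_word m :
  energy adjacency (vertex_type m) =
  (vnum G ^ 2)%:R * word_energy word_weight word_adjacency m.
Proof.
rewrite /energy /word_energy mulr_sumr; apply: eq_bigr => -[a b] _ /=.
rewrite (sum2_word_weight m (fun w w' => word_adjacency a b (w, w') ^+ 2)).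
rewrite mulrC divfK ?pnatr_eq0 ?expn_eq0 ?andbT -?lt0n ?lt0n ?G_gt0//;
  last by rewrite -lt0n.
apply: eq_bigr => u _; apply: eq_bigr => v _; rewrite /word_adjacency/=.
by rewrite size_vertex_type.
Qed.

Definition loop_factor (k : nat) (H : edge_set k) (f : {ffun 'I_k -> V}) : R :=
  \prod_(i < k) (if (i, i) \in H then ((f i, f i) \in edges G)%:R
                 else 1 - ((f i, f i) \in edges G)%:R).

Lemma pullback_density_kernel k (H : edge_set k) :
  pullback_density R G H =
  (\sum_(f : {ffun 'I_k -> V})
    (\prod_(p : 'I_k * 'I_k | (p.1 < p.2)%N)
      adjacency ((p.1, p.2) \in H, (p.2, p.1) \in H) (f p.1) (f p.2)) *
    loop_factor H f) / (vnum G ^ k)%:R.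
Proof.
rewrite /pullback_density; congr (_ / _).
rewrite -sum1_card natr_sum big_mkcond/=; apply: eq_bigr => f _.
rewrite inE; have [fH|fH] := eqVneq (pullback f) H.
  have fE i j : ((f i, f j) \in edges G) = ((i, j) \in H) by rewrite -fH inE.
  rewrite big1 => [|p _]; last by rewrite /adjacency !fE !eqxx.
  rewrite mul1r /loop_factor big1// => i _; rewrite fE.
  by case: (_ \in _) => //=; rewrite subr0.
have /existsP[[i j] ij] : [exists ij, (ij \in pullback f) != (ij \in H)].
  apply: contraR fH; rewrite negb_exists => /forallP fH.
  by apply/eqP/setP => ij; apply/eqP; rewrite -[_ == _]negbK.
rewrite inE/= in ij.
have [ltij|ltji|eqij] := ltngtP i j.
- rewrite (bigD1 (i, j))//= {1}/adjacency/= (negPf ij) !mul0r//.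
- rewrite (bigD1 (j, i))//= {1}/adjacency/= (negPf ij) andbF !mul0r//.
- have {}eqij := val_inj eqij; subst j.
  rewrite [loop_factor H f](bigD1 i)//=; move: ij.
  by case: (_ \in _); case: (_ \in _) => //= _; rewrite ?subrr !mul0r mulr0.
Qed.

(** A type of positive length ends with the loop letter, so the loop factors are those of
    [pullback_density_kernel]; only the pair factors are averaged. *)
Lemma word_density_kernel m k (H : edge_set k) :
  word_density word_weight word_adjacency m.+1 H =
  (\sum_(f : {ffun 'I_k -> V})
    (\prod_(p : 'I_k * 'I_k | (p.1 < p.2)%N)
      block_density (vertex_type m.+1)
        (adjacency ((p.1, p.2) \in H, (p.2, p.1) \in H))
        (vertex_type m.+1 (f p.1)) (vertex_type m.+1 (f p.2))) *
    loop_factor H f) / (vnum G ^ k)%:R.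
Proof.
rewrite /word_density (sum_tuple_word_weight m.+1
  (fun x : k.-tuple (seq letter) =>
    kernel_pmf word_adjacency (@loop_letter R) x H)).
congr (_ / _); apply: eq_bigr => f _; rewrite /kernel_pmf; congr (_ * _).
  apply: eq_bigr => p _.
  by rewrite /word_adjacency/= !tnth_mktuple size_vertex_type.
by apply: eq_bigr => i _; rewrite tnth_mktuple /loop_letter last_types.
Qed.

Lemma pullback_word_density m k (H : edge_set k) :
  `|pullback_density R G H - word_density word_weight word_adjacency m.+1 H| <=
  (k ^ 2)%:R * Num.sqrt (word_energy word_weight word_adjacency m.+2 -
                         word_energy word_weight word_adjacency m.+1).
Proof.
set e := Num.sqrt _; set N := vnum G.
rewrite pullback_density_kernel word_density_kernel -mulrBl.
have Nk : 0 < (N ^ k)%:R :> R by rewrite ltr0n expn_gt0 G_gt0.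
have N2 : 0 < (N ^ 2)%:R :> R by rewrite ltr0n expn_gt0 G_gt0.
rewrite normrM [`|_^-1|]ger0_norm ?invr_ge0 ?(ltW Nk)// ler_pdivrMr//.
rewrite -(ler_pM2r N2).
(* Each unordered pair once, in increasing order, as [counting] demands; at most [k ^ 2] of them. *)
pose r := [seq p : 'I_k * 'I_k <- index_enum ('I_k * 'I_k)%type | (p.1 < p.2)%N].
have rlt p : p \in r -> (p.1 < p.2)%N by rewrite mem_filter => /andP[].
have szr : (size r <= k ^ 2)%N.
  rewrite size_filter (leq_trans (count_size _ _))//.
  by rewrite -[index_enum _]enumT -cardT card_prod card_ord.
apply: (@le_trans _ _ ((size r)%:R * ((N ^ 2)%:R * e * (N ^ k)%:R))); last first.
  rewrite [leRHS](_ : _ = (k ^ 2)%:R * ((N ^ 2)%:R * e * (N ^ k)%:R)); last by ring.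
  apply: ler_wpM2r; last by rewrite ler_nat.
  by rewrite mulr_ge0 ?(ltW Nk)// mulr_ge0 ?(ltW N2)// sqrtr_ge0.
under eq_bigr do rewrite -big_filter -/r.
under [X in _ - X]eq_bigr do rewrite -big_filter -/r.
have := @counting R 'I_k V r
  (fun p => adjacency ((p.1, p.2) \in H, (p.2, p.1) \in H))
  (fun p u v => block_density (vertex_type m.+1)
        (adjacency ((p.1, p.2) \in H, (p.2, p.1) \in H))
        (vertex_type m.+1 u) (vertex_type m.+1 v)) (loop_factor H) ((N ^ 2)%:R * e).
rewrite !card_ord -/N; apply.
- by rewrite filter_uniq// index_enum_uniq.
- by move=> p /rlt; rewrite ltn_neqAle => /andP[].
- move=> p q /rlt pr /rlt qr; apply/eqP => pq.
  by move: pr; rewrite pq/= => /(ltn_trans qr); rewrite ltnn.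
- by move=> p u v; exact: adjacency01.
- by move=> p u v; apply: block_density01 => u' v'; exact: adjacency01.
- move=> p /rlt pr; apply: splits_prod => i _.
  have p12 : p.1 != p.2 by move: pr; rewrite ltn_neqAle => /andP[].
  apply: (@splits_vertex _ _ _ _ _ (fun v =>
    if (i, i) \in H then ((v, v) \in edges G)%:R
    else 1 - ((v, v) \in edges G)%:R)) => // v.
  by case: (_ \in H); case: (_ \in _); rewrite ?subrr ?subr0 ?lexx ?ler01.
- move=> p phi psi phi01 psi01.
  (* The cut norm is at most [N ^ 2 * e]: [types_discrepancy] bounds its square by [N ^ 2] times an
     increment of [energy], itself [N ^ 2] times one of [word_energy]. *)
  have e0 : 0 <= (N ^ 2)%:R * e by rewrite mulr_ge0// sqrtr_ge0.
  rewrite -(@ler_sqr _ `|_| ((N ^ 2)%:R * e)) ?nnegrE// real_normK ?num_real//.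
  rewrite exprMn sqr_sqrtr; last first.
    rewrite subr_ge0 -(ler_pM2l N2) -!energy_word.
    exact: (energy_types_homo _ _ _ (leqnSn m.+1)).
  rewrite expr2 -mulrA mulrBr -!energy_word.
  have := types_discrepancy (false, false) adjacency
    (fun v : V => (v, v) \in edges G) m
    ((p.1, p.2) \in H, (p.2, p.1) \in H) phi01 psi01.
  by rewrite card_ord.
Qed.

End DigraphWords.

(** * Limits of the block densities *)

Lemma fmap_ultra (T T' : Type) (U : set_system T) (u : T -> T') :
  UltraFilter U -> UltraFilter (u x @[x --> U]).
Proof.
move=> UU; split; first exact: fmap_proper_filter.
move=> F FF UF; apply/seteqP; split=> // A FA.
have [//|UA] := in_ultra_setVsetC (u @^-1` A) UU.
have /filter_ex[x []//] : F (A `&` ~` A) by apply: filterI => //; exact: UF.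
Qed.

Lemma ultra_cvg01 (R : realType) (T : Type) (U : set_system T) (UU : UltraFilter U)
    (u : T -> R) : (\forall x \near U, 0 <= u x <= 1) ->
  cvg (u x @[x --> U]).
Proof.
move=> u01; have : compact `[0 : R, 1 : R] by exact: segment_compact.
rewrite compact_ultra => /(_ (u x @[x --> U]))[||l [_ ul]].
- exact: fmap_ultra.
- by apply: filterS u01 => x; rewrite /= in_itv.
- by apply/cvg_ex; exists l.
Qed.

(** Each field is an equation or a non-strict inequality between continuous functions of finitely
    many weights and densities, so it passes to the limit; none divides by a weight, as weights may
    tend to 0. *)
Record word_limit (R : realType) (Gamma : digraph_limit R) := WordLimit {
  wl_weight : seq letter -> R;
  wl_density : bool -> bool -> seq letter * seq letter -> R;
  wl_weight_nil : wl_weight [::] = 1;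
  wl_weight_ge0 : forall w, 0 <= wl_weight w;
  wl_weight_cons : forall w, wl_weight w = \sum_(l : letter) wl_weight (l :: w);
  wl_density01 : forall a b z, 0 <= wl_density a b z <= 1;
  wl_density_sym : forall a b w w', size w = size w' ->
    wl_density a b (w, w') = wl_density b a (w', w);
  wl_density_sum : forall w w', size w = size w' ->
    wl_weight w * wl_weight w' *
      (\sum_(c : bool * bool) wl_density c.1 c.2 (w, w')) =
    wl_weight w * wl_weight w';
  wl_martingale : forall m a b (h : seq letter -> seq letter -> R),
    \sum_(w : m.+1.-tuple letter) \sum_(w' : m.+1.-tuple letter)
      wl_weight w * wl_weight w' *
      (wl_density a b (val w, val w') * h (behead w) (behead w')) =
    \sum_(w : m.-tuple letter) \sum_(w' : m.-tuple letter)
      wl_weight w * wl_weight w' * (wl_density a b (val w, val w') * h w w');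
  wl_approx : forall m k (H : edge_set k),
    `|lim_density Gamma H - word_density wl_weight wl_density m.+1 H| <=
    (k ^ 2)%:R * Num.sqrt (word_energy wl_weight wl_density m.+2 -
                           word_energy wl_weight wl_density m.+1) }.

Lemma word_limit_exists (R : realType) (Gamma : digraph_limit R) :
  inhabited (word_limit Gamma).
Proof.
have [G GP] := t_limP Gamma.
(* A single ultrafilter gives limits to all weights and densities at once; being finer than the
   filter of eventual properties, it preserves [lim_density]. *)
have [U [UU sub]] := ultraFilterLemma (eventually_filter).
have N0 : \forall n \near U, (0 < vnum (G n))%N.
  by apply: sub; exact: GP.1 (nbhs_infty_gt 0%N).
pose ulim (u : nat -> R) : R := lim (u n @[n --> U]).
have ulimP (u : nat -> R) : (\forall n \near U, 0 <= u n <= 1) ->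
    u n @[n --> U] --> ulim u.
  exact: ultra_cvg01.
pose s w := ulim (fun n => word_weight R (G n) w).
pose D a b z := ulim (fun n => @word_adjacency R (G n) a b z).
have sP w : word_weight R (G n) w @[n --> U] --> s w.
  apply: ulimP; apply: filterS N0 => n n0.
  by rewrite word_weight_ge0 word_weight_le1.
have DP a b z : @word_adjacency R (G n) a b z @[n --> U] --> D a b z.
  by apply: ulimP; apply: nearW => n; exact: word_adjacency01.
have ueq (f g : nat -> R) (l l' : R) : f n @[n --> U] --> l ->
    g n @[n --> U] --> l' -> (\forall n \near U, f n = g n) -> l = l'.
  move=> fl gl fg.
  have fl' : g n @[n --> U] --> l by exact: cvg_near_eq fl _ fg.
  exact: (@cvg_unique _ (@norm_hausdorff _ R^o) _ _ _ _ fl' gl).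
have sum_cvg m a b (h : seq letter -> seq letter -> R) :
    \sum_(w : m.-tuple letter) \sum_(w' : m.-tuple letter)
      word_weight R (G n) w * word_weight R (G n) w' *
      (@word_adjacency R (G n) a b (val w, val w') * h w w') @[n --> U] -->
    \sum_(w : m.-tuple letter) \sum_(w' : m.-tuple letter)
      s w * s w' * (D a b (val w, val w') * h w w').
  do 2![apply: cvg_sumr => ? _]; apply: cvgM; first exact: cvgM.
  by apply: cvgM => //; exact: cvg_cst.
have energy_cvg m : word_energy (word_weight R (G n)) (@word_adjacency R (G n)) m
    @[n --> U] --> word_energy s D m.
  do 3![apply: cvg_sumr => ? _]; apply: cvgM; first exact: cvgM.
  by under eq_fun do rewrite expr2; rewrite expr2; exact: cvgM.
have density_cvg m k (H : edge_set k) :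
    word_density (word_weight R (G n)) (@word_adjacency R (G n)) m H
      @[n --> U] --> word_density s D m H.
  apply: cvg_sumr => ws _; apply: cvgM; first by apply: cvg_prodr => i _.
  apply: cvgM; last exact: cvg_cst.
  by apply: cvg_prodr => p _.
constructor; apply: (@WordLimit R Gamma s D).
- apply: (ueq _ _ _ _ (sP [::]) (cvg_cst (1 : R))).
  by apply: filterS N0 => n n0; exact: word_weight_nil.
- move=> w; apply: (ler_cvg_to (cvg_cst (0 : R)) (sP w)).
  by apply: nearW => n; exact: word_weight_ge0.
- move=> w; apply: (ueq _ _ _ _ (sP w) (cvg_sumr (fun l _ => sP (l :: w)))).
  by apply: nearW => n; exact: word_weight_cons.
- move=> a b z; apply/andP; split.
    apply: (ler_cvg_to (cvg_cst (0 : R)) (DP a b z)).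
    by apply: nearW => n; have /andP[] := word_adjacency01 R (G n) a b z.
  apply: (ler_cvg_to (DP a b z) (cvg_cst (1 : R))).
  by apply: nearW => n; have /andP[] := word_adjacency01 R (G n) a b z.
- move=> a b w w' ww'; apply: (ueq _ _ _ _ (DP a b _) (DP b a _)).
  by apply: nearW => n; exact: word_adjacency_sym.
- move=> w w' ww'.
  have sw : word_weight R (G n) w * word_weight R (G n) w'
      @[n --> U] --> s w * s w'.
    exact: cvgM.
  have Dc : \sum_(c : bool * bool) @word_adjacency R (G n) c.1 c.2 (w, w')
      @[n --> U] --> \sum_(c : bool * bool) D c.1 c.2 (w, w').
    by apply: cvg_sumr => c _; exact: DP.
  have sD : word_weight R (G n) w * word_weight R (G n) w' *
      (\sum_(c : bool * bool) @word_adjacency R (G n) c.1 c.2 (w, w'))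
      @[n --> U] --> s w * s w' * \sum_(c : bool * bool) D c.1 c.2 (w, w').
    exact: cvgM.
  apply: (ueq _ _ _ _ sD sw).
  by apply: nearW => n; exact: word_adjacency_sum.
- move=> m a b h; apply: (ueq _ _ _ _ (sum_cvg m.+1 a b
    (fun w w' => h (behead w) (behead w'))) (sum_cvg m a b h)).
  by apply: filterS N0 => n n0; exact: word_adjacency_martingale.
- move=> m k H.
  have pl : pullback_density R (G n) H @[n --> U] --> lim_density Gamma H.
    move=> A /(lim_densityP GP); exact: sub.
  have lc : `|pullback_density R (G n) H -
      word_density (word_weight R (G n)) (@word_adjacency R (G n)) m.+1 H|
      @[n --> U] --> `|lim_density Gamma H - word_density s D m.+1 H|.
    by apply: cvg_norm; apply: cvgB.
  have ec : Num.sqrt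
      (word_energy (word_weight R (G n)) (@word_adjacency R (G n)) m.+2 -
       word_energy (word_weight R (G n)) (@word_adjacency R (G n)) m.+1)
      @[n --> U] --> Num.sqrt (word_energy s D m.+2 - word_energy s D m.+1).
    apply: continuous_cvg; first exact: sqrt_continuous.
    by apply: cvgB.
  apply: (ler_cvg_to lc (cvgM (cvg_cst ((k ^ 2)%:R : R)) ec)).
  by apply: filterS N0 => n n0; exact: pullback_word_density.
Qed.

(** * Coding words by intervals *)

Section FiniteLaw.
Context d (S : measurableType d) (R : realType) (mu : probability S R).
Context (T : finType) (f : S -> T) (p : T -> R).
Hypothesis f_measurable : forall t, measurable (f @^-1` [set t]).
Hypothesis f_law : forall t, mu (f @^-1` [set t]) = (p t)%:E.

Lemma finite_decomposition (h : T -> R) x :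
  h (f x) = \sum_t h t * \1_(f @^-1` [set t]) x.
Proof.
rewrite (bigD1 (f x))//= indicE mem_set// mulr1 big1 ?addr0// => t /eqP tfx.
by rewrite indicE memNset ?mulr0// => /= e; apply: tfx.
Qed.

Lemma measurable_finite_comp (h : T -> R) : measurable_fun [set: S] (h \o f).
Proof.
rewrite (_ : h \o f = fun x => \sum_t h t * \1_(f @^-1` [set t]) x); last first.
  by apply/funext => x; rewrite -finite_decomposition.
by apply: measurable_sum => t; exact: measurable_funM.
Qed.

Lemma law_ge0 t : 0 <= p t.
Proof. by rewrite -lee_fin -f_law. Qed.

Lemma integral_finite (h : T -> R) : (forall t, 0 <= h t) ->
  (\int[mu]_x (h (f x))%:E = (\sum_t p t * h t)%:E)%E.
Proof.
move=> h0; under eq_integral do rewrite finite_decomposition -sumEFin.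
rewrite ge0_integral_sum//; last 2 first.
- by move=> t; apply/measurable_EFinP; exact: measurable_funM.
- by move=> t x _; rewrite lee_fin mulr_ge0.
rewrite -sumEFin; apply: eq_bigr => t _.
under eq_integral do rewrite EFinM.
rewrite ge0_integralZl//; last 2 first.
- by apply/measurable_EFinP; exact: measurable_indic.
- by rewrite lee_fin.
rewrite integral_indic// setIT [RHS]EFinM muleC; congr (_ * _)%E.
exact: f_law.
Qed.

Lemma integral_finite2 (h : T -> T -> R) : (forall t t', 0 <= h t t') ->
  (\int[(mu \x mu)]_z (h (f z.1) (f z.2))%:E =
   (\sum_t \sum_t' p t * p t' * h t t')%:E)%E.
Proof.
move=> h0; have mh : measurable_fun [set: S * S] (fun z => h (f z.1) (f z.2)).
  rewrite (_ : (fun z => _) = fun z : S * S =>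
      \sum_t (h t (f z.2)) * (f z.1 == t)%:R); last first.
    apply/funext => z; rewrite (bigD1 (f z.1))//= eqxx mulr1 big1 ?addr0// => t.
    by rewrite eq_sym => /negPf ->; rewrite mulr0.
  apply: measurable_sum => t; apply: measurable_funM.
    apply: (measurableT_comp (f := h t \o f)) => //.
    exact: measurable_finite_comp.
  apply: (measurableT_comp (f := (fun t' => (t' == t)%:R : R) \o f)) => //.
  exact: measurable_finite_comp.
rewrite fubini_tonelli1//=; last 2 first.
- exact/measurable_EFinP.
- by move=> z; rewrite lee_fin.
rewrite /fubini_F/=.
under eq_integral => x _ do rewrite (integral_finite (h0 (f x))).
rewrite (integral_finite (h := fun t => \sum_t' p t' * h t t')); last first.
  by move=> t; apply: sumr_ge0 => t' _; rewrite mulr_ge0// law_ge0.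
congr EFin; apply: eq_bigr => t _; rewrite mulr_sumr.
by apply: eq_bigr => t' _; rewrite mulrA.
Qed.

Lemma measurable_tuple_finite k (h : k.-tuple T -> R) :
  measurable_fun [set: k.-tuple S] (fun x => h (map_tuple f x)).
Proof.
rewrite (_ : (fun x => _) = fun x : k.-tuple S => \sum_(ts : k.-tuple T)
    h ts * \prod_(i < k) (f (tnth x i) == tnth ts i)%:R); last first.
  apply/funext => x; rewrite (bigD1 (map_tuple f x))//= big1 ?mulr1; last first.
    by move=> i _; rewrite tnth_map eqxx.
  rewrite big1 ?addr0// => ts tsx.
  have /existsP[i fi] : [exists i, f (tnth x i) != tnth ts i].
    apply: contraR tsx; rewrite negb_exists => /forallP tsx.
    apply/eqP/eq_from_tnth => i; rewrite tnth_map; apply/esym/eqP.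
    by rewrite -[_ == _]negbK.
  by rewrite (bigD1 i)//= (negPf fi) mul0r mulr0.
apply: measurable_sum => ts; apply: measurable_funM => //.
apply: measurable_prod => i _.
apply: (measurableT_comp (f := (fun t => (t == tnth ts i)%:R : R) \o f)).
  exact: measurable_finite_comp.
exact: measurable_tnth.
Qed.

Lemma sum_tupleS k (h : k.+1.-tuple T -> R) :
  \sum_ts h ts = \sum_t \sum_(ts : k.-tuple T) h [tuple of t :: ts].
Proof.
rewrite pair_bigA/= (reindex (fun q : T * k.-tuple T => [tuple of q.1 :: q.2]))//=.
exists (fun ts : k.+1.-tuple T => (thead ts, [tuple of behead ts]))
    => [[t ts] _|ts _] /=.
  by rewrite theadE; congr pair; apply: val_inj.
by rewrite -tuple_eta.
Qed.

Lemma integral_iid_finite k (h : k.-tuple T -> R) : (forall ts, 0 <= h ts) ->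
  (\int[iid mu k]_x (h (map_tuple f x))%:E =
   (\sum_(ts : k.-tuple T) (\prod_(i < k) p (tnth ts i)) * h ts)%:E)%E.
Proof.
elim: k h => [|k IH] h h0.
  rewrite /= integral_dirac//; last first.
    by apply/measurable_EFinP; exact: measurable_tuple_finite.
  rewrite diracE mem_set// mul1e (bigD1 [tuple])//= big_ord0 mul1r.
  rewrite big1 ?addr0 => [|ts /negP[]]; last first.
    by apply/eqP/val_inj; rewrite /= (size0nil (size_tuple ts)).
  by congr (h _)%:E; exact: val_inj.
rewrite integral_iidS; last 2 first.
- by apply/measurable_EFinP; exact: measurable_tuple_finite.
- by move=> x; rewrite lee_fin.
transitivity (\int[mu]_x (\sum_(ts : k.-tuple T) (\prod_(i < k) p (tnth ts i)) *
    h [tuple of f x :: ts])%:E)%E.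
  apply: eq_integral => x _; rewrite -(IH (fun ts => h [tuple of f x :: ts]))//.
  apply: eq_integral => xs _; congr (h _)%:E.
  by apply: val_inj.
rewrite (integral_finite (h := fun t => \sum_(ts : k.-tuple T)
    (\prod_(i < k) p (tnth ts i)) * h [tuple of t :: ts])); last first.
  move=> t; apply: sumr_ge0 => ts _; rewrite mulr_ge0// prodr_ge0// => i _.
  exact: law_ge0.
congr EFin; rewrite sum_tupleS; apply: eq_bigr => t _; rewrite mulr_sumr.
apply: eq_bigr => ts _; rewrite big_ord_recl mulrA tnth0; congr (_ * _ * _).
by apply: eq_bigr => i _; rewrite tnthS.
Qed.

End FiniteLaw.

Section UnitLebesgue.
Context (R : realType).

(** A probability on the whole line, carried by [0, 1[: the coding facts, valid for points of [0,
    1[, become almost sure. *)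
Definition unit_lebesgue : set (measurableTypeR R) -> \bar R :=
  mrestr lebesgue_measure (measurable_itv `[0 : R, 1 : R[).

HB.instance Definition _ := Measure.copy unit_lebesgue
  (mrestr lebesgue_measure (measurable_itv `[0 : R, 1 : R[)).

Lemma unit_lebesgue_setT : unit_lebesgue setT = 1%E.
Proof.
rewrite /unit_lebesgue /mrestr setTI lebesgue_measure_itv/= lte_fin ltr01.
by rewrite oppr0 adde0.
Qed.

HB.instance Definition _ :=
  @Measure_isProbability.Build _ _ _ unit_lebesgue unit_lebesgue_setT.

End UnitLebesgue.

Section IntervalCoding.
Context (R : realType) (s : seq letter -> R).
Hypothesis s_nil : s [::] = 1.
Hypothesis s_ge0 : forall w, 0 <= s w.
Hypothesis s_cons : forall w, s w = \sum_(l : letter) s (l :: w).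

(* The word [w] is coded by the interval [left_end w, left_end w + s w[: the
   intervals of the four words [l :: w] are consecutive and cover that of [w]. *)
Fixpoint left_end (w : seq letter) : R :=
  match w with
  | [::] => 0
  | (b1, b2) :: w' => left_end w' +
     (if b1 then s ((false, false) :: w') + s ((false, true) :: w') else 0) +
     (if b2 then s ((b1, false) :: w') else 0)
  end.

(** The four children of [w] lie in lexicographic order: the first comparison finds the first bit of
    the letter, the second one its second bit. Words of weight 0 have empty intervals and are never
    the word of a point of [0, 1[. *)
Fixpoint word_at (m : nat) (x : R) : seq letter :=
  match m with
  | 0 => [::]
  | m'.+1 => let w := word_at m' x in
     let b1 := left_end ((true, false) :: w) <= x in
     let b2 := left_end ((b1, true) :: w) <= x in
     (b1, b2) :: w
  end.

Lemma s_cons4 w : s w = s ((false, false) :: w) + s ((false, true) :: w) +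
  (s ((true, false) :: w) + s ((true, true) :: w)).
Proof.
transitivity (\sum_a \sum_b s ((a, b) :: w)).
  by rewrite s_cons pair_bigA/=; apply: eq_bigr => -[].
by rewrite !big_bool/=; ring.
Qed.

Lemma size_word_at m x : size (word_at m x) = m.
Proof. by elim: m => //= m ->. Qed.

Lemma behead_word_at m x : behead (word_at m.+1 x) = word_at m x.
Proof. by []. Qed.

Lemma left_end_in l w x :
  left_end (l :: w) <= x < left_end (l :: w) + s (l :: w) ->
  left_end w <= x < left_end w + s w.
Proof.
have := s_cons4 w.
have := s_ge0 ((false, false) :: w); have := s_ge0 ((false, true) :: w).
have := s_ge0 ((true, false) :: w); have := s_ge0 ((true, true) :: w).
case: l => [[] []] /= ? ? ? ? -> /andP[? ?]; apply/andP; split; lra.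
Qed.

Lemma word_atP m x w : 0 <= x < 1 -> size w = m ->
  (word_at m x == w) = (left_end w <= x < left_end w + s w).
Proof.
move=> x01; elim: m w => [|m IH] [|[b1 b2] w]//= => [_|[wm]].
  by rewrite s_nil add0r x01.
have := s_cons4 w.
have := s_ge0 ((false, false) :: w); have := s_ge0 ((false, true) :: w).
have := s_ge0 ((true, false) :: w); have := s_ge0 ((true, true) :: w).
move=> s11 s10 s01 s00 sw.
have IHw := IH _ wm.
have [e|ne] := eqVneq (word_at m x) w; last first.
  transitivity false; first by rewrite eqseq_cons (negPf ne) andbF.
  apply/esym/negbTE; apply: contra ne => h; rewrite IHw.
  exact: (@left_end_in (b1, b2)).
rewrite e eqxx in IHw; have /esym/andP[h1 h2] := IHw.
rewrite e eqseq_cons eqxx andbT xpair_eqE.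
rewrite /= {e IHw IH wm} !addr0.
by case: b1; case: b2; rewrite /= ?addr0;
  do ?[case: lerP => ?; rewrite /= ?addr0]; rewrite //; exfalso; lra.
Qed.

Lemma left_end_ge0 w : 0 <= left_end w.
Proof.
elim: w => //= -[b1 b2] w IH; rewrite !addr_ge0//.
  by case: b1 => //; rewrite addr_ge0.
by case: b2.
Qed.

Lemma right_end_le1 w : left_end w + s w <= 1.
Proof.
elim: w => [|[b1 b2] w IH] /=; first by rewrite s_nil add0r.
apply: le_trans IH; rewrite (s_cons4 w).
have := s_ge0 ((false, false) :: w); have := s_ge0 ((false, true) :: w).
have := s_ge0 ((true, false) :: w); have := s_ge0 ((true, true) :: w).
by move=> ? ? ? ?; case: b1; case: b2 => /=; lra.
Qed.

Lemma measurable_word_at m w : measurable (word_at m @^-1` [set w]).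
Proof.
elim: m w => [|m IH] w.
  have [->|w0] := eqVneq w [::].
    by rewrite (_ : _ @^-1` _ = setT)//; apply/seteqP; split.
  rewrite (_ : _ @^-1` _ = set0)//; apply/seteqP; split=> // x /= e.
  by move: w0; rewrite -e eqxx.
case: w => [|[b1 b2] w].
  by rewrite (_ : _ @^-1` _ = set0)//; apply/seteqP; split.
have mle (a : R) b : measurable [set x : R | (a <= x) = b].
  rewrite (_ : [set x | _] = if b then `[a, +oo[%classic else `]-oo, a[%classic).
    by case: b; exact: measurable_itv.
  apply/seteqP; split=> x; case: b => /=; rewrite in_itv /= ?andbT//.
  - by move=> /negbT; rewrite -ltNge.
  - by move=> xa; apply/negbTE; rewrite -ltNge.
rewrite (_ : _ @^-1` _ = word_at m @^-1` [set w] `&`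
   ([set x | (left_end ((true, false) :: w) <= x) = b1] `&`
    [set x | (left_end ((b1, true) :: w) <= x) = b2])).
  by apply: measurableI => //; apply: measurableI; exact: mle.
apply/seteqP; split=> x /=.
  by move=> [+ + xw]; rewrite xw => b1E; rewrite b1E => b2E.
by move=> [-> [-> ->]].
Qed.

Lemma unit_lebesgue_word_at m w : size w = m ->
  unit_lebesgue (word_at m @^-1` [set w]) = (s w)%:E.
Proof.
move=> wm; rewrite /unit_lebesgue /mrestr.
rewrite (_ : _ `&` _ = `[left_end w, left_end w + s w[%classic); last first.
  apply/seteqP; split=> x /=; rewrite !in_itv/=.
    by move=> [e x01]; rewrite -(word_atP x01 wm) e.
  move=> xw; have x01 : 0 <= x < 1.
    move/andP: xw => [x0 x1]; rewrite (le_trans (left_end_ge0 w) x0)/=.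
    exact: lt_le_trans x1 (right_end_le1 w).
  by split=> //; apply/eqP; rewrite (word_atP x01 wm).
rewrite lebesgue_measure_itv/= lte_fin.
case: ltrP => [_|]; first by rewrite -EFinB addrC addKr.
by rewrite gerDl => s0; congr EFin; apply/eqP; rewrite eq_le s_ge0.
Qed.

End IntervalCoding.

(** * The limit kernel *)

(** Steps of L^2 norm at most 2^-i have absolute values whose sum has a finite integral, hence is
    finite almost everywhere; there the telescoping series converges absolutely. *)
Lemma ae_cvg_sqr_increments d (T : measurableType d) (R : realType)
    (nu : probability T R) (u : nat -> T -> R) :
  (forall i, measurable_fun [set: T] (u i)) ->
  (forall i, \int[nu]_x ((u i.+1 x - u i x) ^+ 2)%:E <= ((4%:R^-1) ^+ i)%:E)%E ->
  {ae nu, forall x, cvgn (u ^~ x)}.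
Proof.
move=> mu_ sq; pose v i x := `|u i.+1 x - u i x|.
have mv i : measurable_fun [set: T] (v i).
  by apply: measurableT_comp => //; exact: measurable_funB.
have mEv i : measurable_fun [set: T] (fun x => (v i x)%:E).
  exact/measurable_EFinP.
have v0 i x : (0 <= (v i x)%:E)%E by rewrite lee_fin /v normr_ge0.
have half0 i : 0 <= 2%:R^-1 ^+ i :> R by rewrite exprn_ge0// invr_ge0.
(* AM-GM: [|y| <= 2 ^ i * y ^ 2 + 2 ^ - i] *)
have Iv i : (\int[nu]_x (v i x)%:E <= (2%:R * (2%:R^-1) ^+ i)%:E)%E.
  have msq : measurable_fun [set: T] (fun x => ((u i.+1 x - u i x) ^+ 2)%:E).
    by apply/measurable_EFinP/measurable_funX; exact: measurable_funB.
  apply: (@le_trans _ _ (\int[nu]_x ((2%:R ^+ i)%:E * ((u i.+1 x - u i x) ^+ 2)%:E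
      + (2%:R^-1 ^+ i)%:E))%E).
    apply: ge0_le_integral => //.
    - by apply: emeasurable_funD => //; exact: measurable_funeM.
    - move=> x _; rewrite -EFinM -EFinD lee_fin /v.
      set y := u i.+1 x - u i x.
      have e0 : 0 < 2%:R ^+ i :> R by rewrite exprn_gt0.
      rewrite exprVn -real_normK ?num_real//; set z := `|y|.
      have := sqr_ge0 (2%:R ^+ i * z - 1); set e := 2%:R ^+ i in e0 *.
      rewrite sqrrB expr1n mulr1 => h.
      rewrite -(ler_pM2l e0) mulrDr divff ?gt_eqF//.
      have : 0 <= e * z by apply: mulr_ge0; [exact: ltW|exact: normr_ge0].
      by move: h; rewrite exprMn expr2; nra.
  rewrite ge0_integralD//; last 2 first.
  - by move=> x _; rewrite -EFinM lee_fin mulr_ge0 ?sqr_ge0 ?exprn_ge0.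
  - exact: measurable_funeM.
  rewrite ge0_integralZl//; last by move=> x _; rewrite lee_fin sqr_ge0.
  rewrite integral_cst//= probability_setT mule1.
  apply: (@le_trans _ _ ((2%:R ^+ i)%:E * (4%:R^-1 ^+ i)%:E + (2%:R^-1 ^+ i)%:E)%E).
    by rewrite leeD2r// lee_wpmul2l.
  rewrite -EFinM -EFinD lee_fin -exprMn.
  have -> : 2%:R * 4%:R^-1 = 2%:R^-1 :> R by lra.
  by rewrite mulr_natl mulr2n.
have Is : (\int[nu]_x (\sum_(i <oo) (v i x)%:E) <= 4%:R%:E)%E.
  rewrite integral_nneseries//.
  apply: lime_le; first by apply: is_cvg_nneseries => i _ _; exact: integral_ge0.
  apply: nearW => n.
  apply: (@le_trans _ _ (\sum_(0 <= i < n) (2%:R * (2%:R^-1) ^+ i)%:E)%E).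
    by apply: lee_sum => i _.
  rewrite sumEFin lee_fin.
  have -> : \sum_(0 <= i < n) 2%:R * 2%:R^-1 ^+ i = 4%:R - 4%:R * 2%:R^-1 ^+ n :> R.
    elim: n => [|n IH]; first by rewrite big_geq// expr0 mulr1 subrr.
    by rewrite big_nat_recr//= IH exprS; field.
  by rewrite gerBl mulr_ge0.
have mS : measurable_fun [set: T] (fun x => \sum_(i <oo) (v i x)%:E)%E.
  by apply: ge0_emeasurable_sum.
have iS : nu.-integrable setT (fun x => \sum_(i <oo) (v i x)%:E)%E.
  apply/integrableP; split=> //.
  apply: le_lt_trans (ltry 4%:R); apply: le_trans Is.
  rewrite le_eqVlt; apply/orP; left; apply/eqP; apply: eq_integral => x _.
  by rewrite gee0_abs// nneseries_ge0.
have := integrable_ae measurableT iS; apply: filterS => x /(_ I) fx.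
have cS : cvgn (series (v ^~ x)).
  apply: nnseries_is_cvg; first by move=> i; exact: normr_ge0.
  by rewrite ltey_eq fx.
have cT : cvgn (series (telescope (u ^~ x))).
  exact: normed_cvg.
rewrite (_ : u ^~ x = cst (u 0%N x) \+ series (telescope (u ^~ x))).
  by apply: is_cvgD => //; exact: is_cvg_cst.
by apply/funext => n; exact: (eq_sum_telescope (u ^~ x) n).
Qed.

Lemma ae_iid_pair d (S : measurableType d) (R : realType) (mu : probability S R)
    k (i j : 'I_k) (P : S * S -> Prop) : (i < j)%N ->
  {ae (mu \x mu)%E, forall z, P z} ->
  {ae iid mu k, forall x, P (tnth x i, tnth x j)}.
Proof.
move=> ij [N [mN N0 PN]].
have mt : measurable_fun [set: k.-tuple S] (fun x => (tnth x i, tnth x j)).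
  by apply/measurable_fun_pair => /=; exact: measurable_tnth.
exists ((fun x : k.-tuple S => (tnth x i, tnth x j)) @^-1` N); split.
- by rewrite -[X in measurable X]setTI; exact: mt.
- have mN' : measurable ((fun x : k.-tuple S => (tnth x i, tnth x j)) @^-1` N).
    by rewrite -[X in measurable X]setTI; exact: mt.
  have : (\int[iid mu k]_x (\1_N (tnth x i, tnth x j) : R)%:E = 0)%E.
    rewrite (@integral_iid_pair _ _ _ mu k i j (fun z => (\1_N z : R)%:E))//.
      by rewrite integral_indic// setIT.
    by apply/measurable_EFinP; exact: measurable_indic.
  move=> I0; transitivity (\int[iid mu k]_x (\1_((fun x : k.-tuple S =>
    (tnth x i, tnth x j)) @^-1` N) x : R)%:E)%E; last exact: I0.
  by rewrite integral_indic// setIT.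
- by move=> x /= Px; apply: PN.
Qed.

Section LimitKernel.
Context (R : realType) (Gamma : digraph_limit R) (wl : word_limit Gamma).

Local Notation S := (measurableTypeR R).
Local Notation mu := (@unit_lebesgue R).
Local Notation s := (wl_weight wl).
Local Notation D := (wl_density wl).
Local Notation E := (word_energy s D).

Definition word_tuple_at m (x : S) : m.-tuple letter :=
  Tuple (introT eqP (size_word_at s m x)).

Lemma word_tuple_fiber m (w : m.-tuple letter) :
  word_tuple_at m @^-1` [set w] = word_at s m @^-1` [set val w].
Proof.
by apply/seteqP; split=> x /= => [<-//|e]; apply: val_inj.
Qed.

Lemma measurable_word_tuple_at m (w : m.-tuple letter) :
  measurable (word_tuple_at m @^-1` [set w]).
Proof. by rewrite word_tuple_fiber; exact: measurable_word_at. Qed.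

Lemma word_tuple_at_law m (w : m.-tuple letter) :
  mu (word_tuple_at m @^-1` [set w]) = (s w)%:E.
Proof.
rewrite word_tuple_fiber; apply: unit_lebesgue_word_at; rewrite ?size_tuple//.
- exact: wl_weight_nil.
- exact: wl_weight_ge0.
- exact: wl_weight_cons.
Qed.

Definition step_kernel m (a b : bool) (z : S * S) : R :=
  D a b (word_at s m z.1, word_at s m z.2).

Lemma step_kernel01 m a b z : 0 <= step_kernel m a b z <= 1.
Proof. exact: wl_density01. Qed.

Lemma step_kernel_sym m a b x y :
  step_kernel m a b (x, y) = step_kernel m b a (y, x).
Proof. by apply: wl_density_sym; rewrite !size_word_at. Qed.

Lemma measurable_word_at2 m (h : seq letter -> seq letter -> R) :
  measurable_fun [set: S * S] (fun z => h (word_at s m z.1) (word_at s m z.2)).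
Proof.
rewrite (_ : (fun z => _) = fun z : S * S => \sum_(w : m.-tuple letter)
    h w (word_at s m z.2) * (word_tuple_at m z.1 == w)%:R); last first.
  apply/funext => z; rewrite (bigD1 (word_tuple_at m z.1))//= eqxx mulr1.
  by rewrite big1 ?addr0// => w; rewrite eq_sym => /negPf ->; rewrite mulr0.
apply: measurable_sum => w; apply: measurable_funM.
  apply: (measurableT_comp
    (f := (fun w' : m.-tuple letter => h w w') \o word_tuple_at m)) => //.
  exact: measurable_finite_comp (@measurable_word_tuple_at m) _.
apply: (measurableT_comp
  (f := (fun w' => (w' == w)%:R : R) \o word_tuple_at m)) => //.
exact: measurable_finite_comp (@measurable_word_tuple_at m) _.
Qed.

Lemma measurable_step_kernel m a b :
  measurable_fun [set: S * S] (step_kernel m a b).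
Proof. exact: (measurable_word_at2 m (fun w w' => D a b (w, w'))). Qed.

Lemma integral_word_at2 m (h : seq letter -> seq letter -> R) :
  (forall w w', 0 <= h w w') ->
  (\int[(mu \x mu)]_z (h (word_at s m z.1) (word_at s m z.2))%:E =
   (\sum_(w : m.-tuple letter) \sum_(w' : m.-tuple letter)
      s w * s w' * h w w')%:E)%E.
Proof.
move=> h0; rewrite -(integral_finite2 (@measurable_word_tuple_at m)
  (@word_tuple_at_law m) (h := fun w w' => h w w'))//.
Qed.

Lemma word_at_add m d x : word_at s m x = iter d behead (word_at s (d + m) x).
Proof.
by elim: d => // d IH; rewrite iterSr addSn behead_word_at.
Qed.

Definition word_inner m (h : seq letter -> seq letter -> R) : R :=
  \sum_(w : m.-tuple letter) \sum_(w' : m.-tuple letter) s w * s w' * h w w'.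

(** Truncating the word of a point at level [d + m] gives its word at level [m], so both sides are
    the integral of one function over the square. *)
Lemma word_inner_iter_behead m d (h : seq letter -> seq letter -> R) :
  (forall w w', 0 <= h w w') ->
  word_inner (d + m) (fun w w' => h (iter d behead w) (iter d behead w')) =
  word_inner m h.
Proof.
move=> h0; apply: EFin_inj; rewrite -[RHS]integral_word_at2//.
rewrite -(@integral_word_at2 _
  (fun w w' => h (iter d behead w) (iter d behead w')))//.
by apply: eq_integral => z _; rewrite !(word_at_add m d).
Qed.

Lemma word_inner_martingale m d a b (h : seq letter -> seq letter -> R) :
  word_inner (d + m) (fun w w' => D a b (w, w') *
    h (iter d behead w) (iter d behead w')) =
  word_inner m (fun w w' => D a b (w, w') * h w w').
Proof.
elim: d h => // d IH h; rewrite -IH.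
apply: etrans (wl_martingale wl (d + m) a b
  (fun w w' => h (iter d behead w) (iter d behead w'))).
apply: eq_bigr => w _; apply: eq_bigr => w' _.
by rewrite -!iterSr.
Qed.

Definition color_energy m a b : R := word_inner m (fun w w' => D a b (w, w') ^+ 2).

(** Orthogonality of martingale increments: by [word_inner_martingale] the cross term is the energy
    of level [m]. *)
Lemma integral_step_kernel_sqr m d a b :
  (\int[(mu \x mu)]_z ((step_kernel (d + m) a b z - step_kernel m a b z) ^+ 2)%:E =
   (color_energy (d + m) a b - color_energy m a b)%:E)%E.
Proof.
pose h w w' := (D a b (w, w') - D a b (iter d behead w, iter d behead w')) ^+ 2.
transitivity (\int[(mu \x mu)]_z
    (h (word_at s (d + m) z.1) (word_at s (d + m) z.2))%:E)%E.
  by apply: eq_integral => z _; rewrite /h -!word_at_add.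
rewrite integral_word_at2; last by move=> w w'; exact: sqr_ge0.
congr EFin; pose q w w' : R := D a b (w, w') ^+ 2.
have q0 w w' : 0 <= q w w' by exact: sqr_ge0.
rewrite -/(word_inner (d + m) h).
have c1 := @word_inner_iter_behead m d q q0.
have c2 := word_inner_martingale m d a b (fun w w' => D a b (w, w')).
transitivity (color_energy (d + m) a b
  - word_inner (d + m) (fun w w' => D a b (w, w') *
      D a b (iter d behead w, iter d behead w')) *+ 2
  + word_inner (d + m) (fun w w' => q (iter d behead w) (iter d behead w'))).
  rewrite /color_energy /word_inner -sumrMnl -sumrB -big_split/=.
  apply: eq_bigr => w _.
  rewrite -sumrMnl -sumrB -big_split/=; apply: eq_bigr => w' _.
  by rewrite /h /q; ring.
rewrite c1 c2 (_ : word_inner m (fun w w' => D a b (w, w') * D a b (w, w')) =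
  color_energy m a b).
  by rewrite /q -/(color_energy m a b); ring.
by apply: eq_bigr => w _; apply: eq_bigr => w' _; rewrite expr2.
Qed.

Lemma color_energy_homo a b m d : color_energy m a b <= color_energy (d + m) a b.
Proof.
rewrite -subr_ge0 -lee_fin -integral_step_kernel_sqr.
by apply: integral_ge0 => z _; rewrite lee_fin sqr_ge0.
Qed.

Lemma word_energyE m : E m = \sum_(c : bool * bool) color_energy m c.1 c.2.
Proof. by []. Qed.

Lemma word_energy_homo : {homo E : m n / (m <= n)%N >-> m <= n}.
Proof.
move=> m n /subnK <-; rewrite !word_energyE; apply: ler_sum => c _.
exact: color_energy_homo.
Qed.

Lemma color_energy_diff m n a b : (m <= n)%N ->
  color_energy n a b - color_energy m a b <= E n - E m.
Proof.
move=> /subnK <-; rewrite !word_energyE -sumrB (bigD1 (a, b))//= lerDl.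
by apply: sumr_ge0 => c _; rewrite subr_ge0 color_energy_homo.
Qed.

Lemma color_energy_le1 m a b : color_energy m a b <= 1.
Proof.
rewrite -lee_fin.
rewrite -(integral_word_at2 m (h := fun w w' => D a b (w, w') ^+ 2)); last first.
  by move=> w w'; exact: sqr_ge0.
apply: (@le_trans _ _ (\int[(mu \x mu)]_z 1)%E).
  apply: ge0_le_integral => //.
  - by move=> z _; rewrite lee_fin sqr_ge0.
  - apply/measurable_EFinP.
    exact: (measurable_word_at2 m (fun w w' => D a b (w, w') ^+ 2)).
  - move=> z _; rewrite lee_fin exprn_ile1//;
      by have /andP[] := wl_density01 wl a b (word_at s m z.1, word_at s m z.2).
rewrite integral_cst//= mul1e -setXTT product_measure1E//=.
by rewrite !probability_setT mule1.
Qed.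

(** The energy is nondecreasing and at most 4, one for each colour, hence converges; the rate 4^-i
    is chosen for its summable square root. *)
Lemma levels_exist : {M : nat -> nat |
  {homo M : i j / (i <= j)%N} /\
  forall i n, (M i < n)%N -> E n - E (M i).+1 <= (4%:R^-1) ^+ i}.
Proof.
have cE : cvgn E.
  apply: nondecreasing_is_cvgn; first exact: word_energy_homo.
  exists 4%:R => _ [m _ <-]; rewrite word_energyE.
  apply: (@le_trans _ _ (\sum_(c : bool * bool) 1)).
    by apply: ler_sum => c _; exact: color_energy_le1.
  by rewrite sumr_const card_prod card_bool.
have lev i : {m | forall n, (m <= n)%N -> limn E - E n <= (4%:R^-1) ^+ i}.
  apply: cid; have e0 : 0 < (4%:R^-1 : R) ^+ i by rewrite exprn_gt0// invr_gt0.
  have /cvgrPdist_le/(_ _ e0)[m _ mP] := cE.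
  exists m => n mn; apply: le_trans (mP n mn).
  by rewrite ler_norm.
(* Partial sums make [M] monotone and keep [M i] at or above [lev i]. *)
exists (fun i => (\sum_(j < i.+1) sval (lev j))%N); split.
  apply: homo_leq => //; first by move=> a b c; exact: leq_trans.
  by move=> i; rewrite [leqRHS]big_ord_recr leq_addr.
move=> i n in'.
apply: le_trans (svalP (lev i) (\sum_(j < i.+1) sval (lev j)).+1 _).
  rewrite lerD2r; apply: nondecreasing_cvgn_le => //.
  exact: word_energy_homo.
by rewrite big_ord_recr/=; apply: leqW; exact: leq_addl.
Qed.

End LimitKernel.

Section LimitQuintuple.
Context (R : realType) (Gamma : digraph_limit R) (wl : word_limit Gamma).

Local Notation S := (measurableTypeR R).
Local Notation mu := (@unit_lebesgue R).
Local Notation s := (wl_weight wl).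
Local Notation D := (wl_density wl).
Local Notation E := (word_energy s D).

Let M := sval (levels_exist wl).
Let M_homo : {homo M : i j / (i <= j)%N} := (svalP (levels_exist wl)).1.
Let M_energy i n : (M i < n)%N -> E n - E (M i).+1 <= (4%:R^-1) ^+ i :=
  (svalP (levels_exist wl)).2 i n.

Definition fast_kernel (i : nat) : bool -> bool -> S * S -> R :=
  step_kernel wl (M i).+1.

(* Truncated, so that it takes its values in [0, 1] also where the step kernels
   do not converge. *)
Definition limit_kernel (a b : bool) (z : S * S) : R :=
  Num.max 0 (Num.min 1 (limn_sup (fun i => fast_kernel i a b z))).

(** The letter of level 1 remains the last one at all later levels, so this is 0 or 1 and involves
    no limit. *)
Definition limit_loop (x : S) : R := loop_letter R (word_at s 1 x).

Lemma limit_kernel01 a b z : 0 <= limit_kernel a b z <= 1.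
Proof. by rewrite /limit_kernel le_max lexx/= ge_max ler01 ge_min lexx. Qed.

Lemma limit_loop01 x : 0 <= limit_loop x <= 1.
Proof. by rewrite /limit_loop /loop_letter ler0n lern1 leq_b1. Qed.

Lemma measurable_fast_kernel i a b :
  measurable_fun [set: S * S] (fast_kernel i a b).
Proof. exact: measurable_step_kernel. Qed.

Lemma measurable_limit_kernel a b : measurable_fun [set: S * S] (limit_kernel a b).
Proof.
apply: measurable_maxr => //; apply: measurable_minr => //.
apply: measurable_fun_limn_sup => [z _|z _|i]; last exact: measurable_fast_kernel.
- by exists 1 => _ [i _ <-]; have /andP[] := step_kernel01 wl (M i).+1 a b z.
- by exists 0 => _ [i _ <-]; have /andP[] := step_kernel01 wl (M i).+1 a b z.
Qed.

Lemma measurable_limit_loop : measurable_fun [set: S] limit_loop.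
Proof.
exact: (measurable_finite_comp (@measurable_word_tuple_at _ _ wl 1)
  (fun w => loop_letter R w)).
Qed.

Lemma limit_kernel_sym a b x y : limit_kernel a b (x, y) = limit_kernel b a (y, x).
Proof.
rewrite /limit_kernel; congr (Num.max _ (Num.min _ (limn_sup _))).
by apply/funext => i; exact: step_kernel_sym.
Qed.

Lemma fast_kernel_cvg a b : {ae (mu \x mu)%E, forall z,
  fast_kernel i a b z @[i --> \oo] --> limit_kernel a b z}.
Proof.
have : {ae (mu \x mu)%E, forall z, cvgn (fun i => fast_kernel i a b z)}.
  apply: (@ae_cvg_sqr_increments _ _ R (mu \x mu)%E (fun i => fast_kernel i a b)).
    by move=> i; exact: measurable_fast_kernel.
  (* From [(M i).+1] to [(M i.+1).+1] the energy of one colour grows by no more than the total does,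
     hence by at most 4^-i. *)
  move=> i; have le : ((M i).+1 <= (M i.+1).+1)%N by rewrite ltnS M_homo.
  rewrite /fast_kernel -{1}(subnK le) integral_step_kernel_sqr lee_fin (subnK le).
  apply: le_trans (color_energy_diff wl a b le) _.
  by apply: M_energy; rewrite ltnS M_homo.
apply: filterS => z cz; have := cz; rewrite /limit_kernel (cvg_limn_supE cz).
have l0 : 0 <= limn (fun i => fast_kernel i a b z).
  apply: limr_ge => //; apply: nearW => i.
  by have /andP[] := step_kernel01 wl (M i).+1 a b z.
have l1 : limn (fun i => fast_kernel i a b z) <= 1.
  apply: limr_le => //; apply: nearW => i.
  by have /andP[] := step_kernel01 wl (M i).+1 a b z.
by rewrite (min_idPr l1) (max_idPr l0).
Qed.

Lemma ae_unit_interval : {ae mu, forall x, 0 <= x < 1}.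
Proof.
exists (~` `[0 : R, 1 : R[%classic); split.
- by apply: measurableC; exact: measurable_itv.
- by rewrite /unit_lebesgue /mrestr setICl measure0.
- by move=> x /= nx; rewrite in_itv.
Qed.

(** A point of [0, 1[ lies in the half-open interval of its word, which is therefore not empty. *)
Lemma weight_word_at_gt0 m x : 0 <= x < 1 -> 0 < s (word_at s m x).
Proof.
move=> x01.
have := word_atP (wl_weight_nil wl) (wl_weight_ge0 wl) (wl_weight_cons wl) x01
  (size_word_at s m x).
rewrite eqxx => /esym/andP[h1 h2].
by have := le_lt_trans h1 h2; rewrite ltrDl.
Qed.

Lemma limit_kernel_sum : {ae (mu \x mu)%E, forall z,
  limit_kernel false false z + limit_kernel false true z +
  limit_kernel true false z + limit_kernel true true z = 1}.
Proof.
apply: filterS3 (fast_kernel_cvg false false) (fast_kernel_cvg false true)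
  (filterI (filterI (fast_kernel_cvg true false) (fast_kernel_cvg true true))
    (filterI (ae_prod1 ae_unit_interval) (ae_prod2 ae_unit_interval))).
move=> z c00 c01 [[c10 c11] [z1 z2]].
have cs : fast_kernel i false false z + fast_kernel i false true z +
    fast_kernel i true false z + fast_kernel i true true z @[i --> \oo] -->
    limit_kernel false false z + limit_kernel false true z +
    limit_kernel true false z + limit_kernel true true z.
  by apply: cvgD => //; apply: cvgD => //; exact: cvgD.
have c1 : fast_kernel i false false z + fast_kernel i false true z +
    fast_kernel i true false z + fast_kernel i true true z @[i --> \oo] --> (1 : R).
  apply: (cvg_near_eq (cvg_cst (1 : R))) => //.
  apply: nearW => i; rewrite /fast_kernel /step_kernel.
  set w := word_at s _ z.1; set w' := word_at s _ z.2.
  (* The relation holds up to the product of two weights, which are positive at points of [0, 1[. *)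
  have := @wl_density_sum _ _ wl w w'; rewrite /w /w' !size_word_at => /(_ erefl).
  rewrite -[RHS]mulr1 => /mulfI.
  rewrite mulf_neq0 ?gt_eqF ?weight_word_at_gt0// => /(_ isT) <-.
  rewrite -(pair_bigA _ (fun a b => D a b (_, _)))/= !big_bool/=; ring.
exact: (@cvg_unique _ (@norm_hausdorff _ R^o) _ _ _ _ cs c1).
Qed.

Definition limit_quintuple : quintuple mu.
Proof.
apply: (@Quintuple _ S R mu limit_kernel limit_loop).
- exact: measurable_limit_kernel.
- exact: measurable_limit_loop.
- exact: limit_kernel01.
- exact: limit_loop01.
- exact: limit_kernel_sum.
- by apply: aeW => z; exact: limit_kernel_sym.
- by apply: aeW => z; exact: limit_kernel_sym.
- by apply: aeW => z; exact: limit_kernel_sym.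
Defined.

Lemma last_word_at m x :
  last (false, false) (word_at s m.+1 x) = last (false, false) (word_at s 1 x).
Proof.
by elim: m => // m IH; rewrite -IH.
Qed.

Lemma integral_fast_kernel i k (H : edge_set k) :
  (\int[iid mu k]_x (kernel_pmf (fast_kernel i) limit_loop x H)%:E =
   (word_density s D (M i).+1 H)%:E)%E.
Proof.
set m := (M i).+1.
pose h (ws : k.-tuple (m.-tuple letter)) : R :=
  kernel_pmf D (@loop_letter R) (map_tuple val ws) H.
have l01 w : 0 <= loop_letter R w <= 1.
  by rewrite /loop_letter ler0n lern1 leq_b1.
have h0 ws : 0 <= h ws.
  by have /andP[] := kernel_pmf_01 (map_tuple val ws) H (wl_density01 wl) l01.
have lE y : limit_loop y = loop_letter R (val (word_tuple_at wl m y)).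
  by rewrite /limit_loop /loop_letter -(last_word_at (M i)).
transitivity (\int[iid mu k]_x (h (map_tuple (word_tuple_at wl m) x))%:E)%E.
  apply: eq_integral => x _; congr EFin; rewrite /h /kernel_pmf; congr (_ * _).
    by apply: eq_bigr => p _; rewrite !tnth_map.
  by apply: eq_bigr => j _; rewrite !tnth_map lE.
rewrite (integral_iid_finite (@measurable_word_tuple_at _ _ wl m)
  (@word_tuple_at_law _ _ wl m))//; congr EFin.
rewrite /word_density (reindex (fun ws : {ffun 'I_k -> m.-tuple letter} =>
  [tuple ws i | i < k])).
  apply: eq_bigr => ws _; congr (_ * _).
    by apply: eq_bigr => j _; rewrite tnth_mktuple.
  by congr kernel_pmf; apply: eq_from_tnth => j; rewrite tnth_map !tnth_mktuple.
exists (fun ts : k.-tuple (m.-tuple letter) => [ffun i => tnth ts i])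
    => [ws _|ts _].
  by apply/ffunP => j; rewrite ffunE tnth_mktuple.
by apply: eq_from_tnth => j; rewrite tnth_mktuple ffunE.
Qed.

Lemma word_density_cvg k (H : edge_set k) :
  word_density s D (M i).+1 H @[i --> \oo] --> lim_density Gamma H.
Proof.
have half1 : `|2%:R^-1 : R| < 1 by rewrite ger0_norm ?invr_ge0// invf_lt1 ?ltr1n.
have half0 := cvg_expr half1.
have bound0 : (k ^ 2)%:R * 2%:R^-1 ^+ i @[i --> \oo] --> ((k ^ 2)%:R * 0 : R).
  by apply: cvgMr.
rewrite mulr0 in bound0.
have d0 : lim_density Gamma H - word_density s D (M i).+1 H
    @[i --> \oo] --> (0 : R).
  apply/norm_cvg0P; apply: squeeze_cvgr bound0; last exact: cvg_cst.
  apply: nearW => i; rewrite normr_ge0/=; apply: le_trans (wl_approx wl (M i) H) _.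
  rewrite ler_wpM2l//.
  (* [wl_approx] at [M i] involves the increment from [(M i).+1] to [(M i).+2], which is at most
     4^-i. *)
  have -> : 2%:R^-1 ^+ i = Num.sqrt ((4%:R^-1 : R) ^+ i).
    have -> : (4%:R^-1 : R) ^+ i = (2%:R^-1 ^+ i) ^+ 2.
      by rewrite -exprM mulnC exprM; congr (_ ^+ _); lra.
    by rewrite sqrtr_sqr ger0_norm// exprn_ge0// invr_ge0.
  by apply: ler_wsqrtr; exact: M_energy.
apply: (cvg_near_eq (cvgB (cvg_cst (lim_density Gamma H)) d0)).
  by rewrite subr0.
by near=> i; rewrite /= opprB addrC subrK.
Unshelve. all: by end_near. Qed.

Lemma limit_quintuple_represents : represents limit_quintuple Gamma.
Proof.
apply/represents_lim_density => k H.
pose f i (x : k.-tuple S) := (kernel_pmf (fast_kernel i) limit_loop x H)%:E.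
(* There are finitely many pairs and colours, so almost every sample has convergence for all of them
   at once; the loop factor is constant in [i]. *)
have ae_pairs : {ae iid mu k, forall x, forall p : 'I_k * 'I_k, (p.1 < p.2)%N ->
    forall a b, fast_kernel i a b (tnth x p.1, tnth x p.2) @[i --> \oo] -->
      limit_kernel a b (tnth x p.1, tnth x p.2)}.
  apply: filter_forall => -[i j].
  have [ij|ij] := boolP (i < j)%N; last by apply: aeW.
  apply: filterS (ae_iid_pair ij (filterI
    (filterI (fast_kernel_cvg false false) (fast_kernel_cvg false true))
    (filterI (fast_kernel_cvg true false) (fast_kernel_cvg true true)))).
  by move=> x [[c00 c01] [c10 c11]] _ [] [].
have ff : {ae iid mu k, forall x, [set: k.-tuple S] x ->
    f ^~ x @ \oo --> (kernel_pmf limit_kernel limit_loop x H)%:E}.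
  apply: filterS ae_pairs => x xP _; apply: cvg_EFin; first exact: nearW.
  apply: cvgM; last exact: cvg_cst.
  by apply: cvg_prodr => p pP; exact: xP.
have k01 (K : bool -> bool -> S * S -> R) x : (forall a b z, 0 <= K a b z <= 1) ->
    0 <= kernel_pmf K limit_loop x H <= 1.
  by move=> K01; exact: (kernel_pmf_01 x H K01 limit_loop01).
have mf i : measurable_fun [set: k.-tuple S] (f i).
  apply/measurable_EFinP; apply: measurable_kernel_pmf => //.
  - by move=> a b; exact: measurable_fast_kernel.
  - exact: measurable_limit_loop.
have ml : measurable_fun [set: k.-tuple S]
    (fun x => (kernel_pmf limit_kernel limit_loop x H)%:E).
  apply/measurable_EFinP; apply: measurable_kernel_pmf => //.
  - by move=> a b; exact: measurable_limit_kernel.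
  - exact: measurable_limit_loop.
have i1 : (iid mu k).-integrable setT (cst 1%E).
  exact: finite_measure_integrable_cst.
have fle : {ae iid mu k, forall x n, [set: k.-tuple S] x ->
    (`|f n x| <= cst 1%E x)%E}.
  apply: aeW => x n _; have /andP[f0 f1] := k01 _ x (step_kernel01 wl (M n).+1).
  by rewrite /f gee0_abs lee_fin.
have [_ _ If] := dominated_convergence measurableT mf ml ff i1 fle.
have Iq : (\int[iid mu k]_x f i x)%E @[i --> \oo] --> (lim_density Gamma H)%:E.
  rewrite (_ : (fun i => _) = fun i =>
    (word_density s D (M i).+1 H)%:E); last first.
    by apply/funext => i; exact: integral_fast_kernel.
  by apply: cvg_EFin; [exact: nearW|exact: word_density_cvg].
exact: (@cvg_unique _ (@ereal_hausdorff R) _ _ _ _ Iq If).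
Qed.

End LimitQuintuple.

(** * The three forbidden digraphs and the cycle of implications *)

Lemma C1_not_tournament : ~ is_tournament C1.
Proof. by move=> [/(_ ord0)]; rewrite inE. Qed.

Lemma C2_not_tournament : ~ is_tournament C2.
Proof. by move=> [_ /(_ ord0 ord_max erefl)]; rewrite !inE. Qed.

Lemma E2_not_tournament : ~ is_tournament E2.
Proof. by move=> [_ /(_ ord0 ord_max erefl)]; rewrite !inE. Qed.

Theorem theorem4p1 (R : realType) (Gamma : digraph_limit R) :
  [<->
    is_tournament_limit Gamma;
    forall F : digraph, ~ is_tournament F -> tind_lim Gamma F = 0;
    tind_lim Gamma C1 = 0 /\ tind_lim Gamma C2 = 0 /\
      tind_lim Gamma E2 = 0;
    forall (d : measure_display) (S : measurableType d)
        (mu : probability S R) (W : quintuple mu),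
      represents W Gamma ->
      {ae mu, forall x, Qw W x = 0} /\
      {ae (mu \x mu)%E, forall z, QW W true true z = 0} /\
      {ae (mu \x mu)%E, forall z, QW W false false z = 0} /\
      {ae (mu \x mu)%E, forall z,
        QW W true false (z.1, z.2) + QW W true false (z.2, z.1) = 1}].
Proof.
tfae.
- by move=> GT F; exact: tournament_limit_tind0.
- move=> tind0; split; last split; apply: tind0.
  + exact: C1_not_tournament.
  + exact: C2_not_tournament.
  + exact: E2_not_tournament.
- rewrite !tind_limE => -[c1 [c2 e2]] d S mu W WG.
  exact: represents_ae WG c1 c2 e2.
- move=> rep; have [wl] := word_limit_exists Gamma.
  have WG := limit_quintuple_represents wl.
  have [w0 [W11 [W00 _]]] := rep _ _ _ _ WG.
  have [c1 c2 e2] := represents_ae_lim_density WG w0 W11 W00.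
  exact: tournament_limit_of_lim_density.
Qed.
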